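(* As formal power series in $q$ (equivalently, as functions for $|q|<1$), $$\sum_{n=0}^\infty \overline{pp}(3n+2)q^n=12\,\frac{(q^2;q^2)_\infty^6\,(q^3;q^3)_\infty^6}{(q;q)_\infty^{14}}$$ and $$\sum_{n=0}^\infty \overline{pp}(4n+3)q^n=32\,\frac{(q^2;q^2)_\infty^{20}}{(q;q)_\infty^{22}}.$$
   Context: For $|q|<1$, $(a;q)_\infty=\prod_{k=1}^\infty(1-aq^{k-1})$. An overpartition of $n$ is a partition of $n$ (a non-increasing sequence of positive integers with sum $n$) in which the first occurrence of each number may be overlined; there is exactly one overpartition of $0$ (the empty one). An overpartition pair of $n$ is an ordered pair $(\lambda,\mu)$ of overpartitions such that the sum of all parts of $\lambda$ and $\mu$ is $n$ (either may be the overpartition of $0$). $\overline{pp}(n)$ denotes the number of overpartition pairs of $n$; its generating function is $\sum_{n\ge 0}\overline{pp}(n)q^n=(-q;q)_\infty^2/(q;q)_\infty^2$. *)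

(* Defs.v *)
From HB Require Import structures.
From mathcomp Require Import all_boot all_order all_algebra finmap.
From mathcomp Require Import boolp classical_sets functions cardinality.

Set Implicit Arguments.
Unset Strict Implicit.
Unset Printing Implicit Defensive.

Import GRing.Theory.

Local Open Scope ring_scope.

(** Formal power series, as coefficient sequences. A record (rather than an
    alias of [nat -> R]) so that products are Cauchy products, not pointwise;
    over a [comUnitRingType], units are the series with unit constant term. *)

Record fps (R : Type) := Fps { fps_coef :> nat -> R }.

Lemma fpsP (R : Type) (f g : fps R) : f =1 g -> f = g.
Proof. by case: f g => [f] [g] /= /funext ->. Qed.

HB.instance Definition _ (R : Type) := gen_eqMixin (fps R).
HB.instance Definition _ (R : Type) := gen_choiceMixin (fps R).

Section Ring.
Variable R : comNzRingType.
Implicit Types f g h : fps R.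

Definition fps_zero : fps R := Fps (fun=> 0).
Definition fps_opp f : fps R := Fps (fun n => - f n).
Definition fps_add f g : fps R := Fps (fun n => f n + g n).

Fact fps_addA : associative fps_add.
Proof. by move=> f g h; apply: fpsP => n /=; rewrite addrA. Qed.
Fact fps_addC : commutative fps_add.
Proof. by move=> f g; apply: fpsP => n /=; rewrite addrC. Qed.
Fact fps_add0 : left_id fps_zero fps_add.
Proof. by move=> f; apply: fpsP => n /=; rewrite add0r. Qed.
Fact fps_addN : left_inverse fps_zero fps_opp fps_add.
Proof. by move=> f; apply: fpsP => n /=; rewrite addNr. Qed.

HB.instance Definition _ :=
  GRing.isZmodule.Build (fps R) fps_addA fps_addC fps_add0 fps_addN.

Definition fps_one : fps R := Fps (fun n => (n == 0%N)%:R).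
Definition fps_mul f g : fps R :=
  Fps (fun n => \sum_(i < n.+1) f i * g (n - i)%N).

Definition fps_trunc (m : nat) f : {poly R} := \poly_(i < m.+1) f i.

Lemma fps_truncE m f i : (i <= m)%N -> (fps_trunc m f)`_i = f i.
Proof. by move=> le_im; rewrite coef_poly ltnS le_im. Qed.

Lemma fps_mul_trunc m f g n : (n <= m)%N ->
  fps_mul f g n = (fps_trunc m f * fps_trunc m g)`_n.
Proof.
move=> le_nm; rewrite coefM; apply: eq_bigr => i _.
by rewrite !fps_truncE // (leq_trans _ le_nm) // ?leq_subr // -ltnS.
Qed.

Fact fps_mulC : commutative fps_mul.
Proof.
by move=> f g; apply: fpsP => n; rewrite !(@fps_mul_trunc n) // mulrC.
Qed.

Fact fps_mulA : associative fps_mul.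
Proof.
move=> f g h; apply: fpsP => n.
have trM u v i : (i <= n)%N ->
    (fps_trunc n (fps_mul u v))`_i = (fps_trunc n u * fps_trunc n v)`_i.
  by move=> le_in; rewrite fps_truncE // (fps_mul_trunc _ _ le_in).
rewrite !(@fps_mul_trunc n) //.
transitivity (fps_trunc n f * (fps_trunc n g * fps_trunc n h))`_n.
  by rewrite 2!coefM; apply: eq_bigr => i _; rewrite trM // leq_subr.
rewrite mulrA 2!coefM; apply: eq_bigr => i _.
by rewrite trM // -ltnS.
Qed.

Fact fps_mul1 : left_id fps_one fps_mul.
Proof.
move=> f; apply: fpsP => n /=.
rewrite big_ord_recl /= mul1r subn0 big1 ?addr0 // => i _.
by rewrite mul0r.
Qed.

Fact fps_mulD : left_distributive fps_mul fps_add.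
Proof.
move=> f g h; apply: fpsP => n /=; rewrite -big_split /=.
by apply: eq_bigr => i _; rewrite mulrDl.
Qed.

Fact fps_one_neq0 : fps_one != 0.
Proof.
apply/eqP => /(congr1 (fun f : fps R => f 0%N)) /= /eqP.
by rewrite oner_eq0.
Qed.

HB.instance Definition _ := GRing.Zmodule_isComNzRing.Build (fps R)
  fps_mulA fps_mulC fps_mul1 fps_mulD fps_one_neq0.

Lemma fps0E n : (0 : fps R) n = 0. Proof. by []. Qed.
Lemma fps1E n : (1 : fps R) n = (n == 0%N)%:R. Proof. by []. Qed.
Lemma fpsDE f g n : (f + g) n = f n + g n. Proof. by []. Qed.
Lemma fpsNE f n : (- f) n = - f n. Proof. by []. Qed.
Lemma fpsME f g n : (f * g) n = \sum_(i < n.+1) f i * g (n - i)%N.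
Proof. by []. Qed.

Definition fpsX : fps R := Fps (fun n => (n == 1%N)%:R).

(** [is_fps_lim u l] is convergence of [u] to [l] for the
    usual (X-adic) topology, that is, every coefficient is eventually constant.
    [fps_lim] is [0] on divergent sequences; see [fps_qpoch_cvg]. *)

Definition is_fps_lim (u : nat -> fps R) (l : fps R) : Prop :=
  forall n, exists N, forall m, (N <= m)%N -> u m n = l n.

Definition fps_lim (u : nat -> fps R) : fps R :=
  xget 0 [set l | is_fps_lim u l]%classic.

Lemma is_fps_lim_unique u l l' : is_fps_lim u l -> is_fps_lim u l' -> l = l'.
Proof.
move=> ul ul'; apply: fpsP => n.
have [N uN] := ul n; have [N' uN'] := ul' n.
by rewrite -(uN (maxn N N')) ?leq_maxl // uN' ?leq_maxr.
Qed.

Lemma fps_limE u l : is_fps_lim u l -> fps_lim u = l.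
Proof.
by move=> ul; apply: xget_unique => // l' ul'; apply: is_fps_lim_unique ul.
Qed.

(** $(a;q)_\infty = \prod_{k \ge 1} (1 - a q^{k-1})$, for series [a] and [q]. *)
Definition qpoch (a q : fps R) : fps R :=
  fps_lim (fun N => \prod_(1 <= k < N.+1) (1 - a * q ^+ k.-1)).

Lemma fps_exp_coef0 (q : fps R) N n : q 0%N = 0 -> (n < N)%N -> (q ^+ N) n = 0.
Proof.
move=> q0; elim: N n => // N IHN n lt_nN.
rewrite exprS fpsME big_ord_recl q0 mul0r add0r big1 // => i _.
rewrite IHN ?mulr0 //= /bump /= add1n.
by case: n lt_nN i => [|n] lt_nN [i lt_i] //=; rewrite subSS (leq_ltn_trans (leq_subr _ _)).
Qed.

Lemma fps_qpoch_cvg (a q : fps R) : q 0%N = 0 ->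
  is_fps_lim (fun N => \prod_(1 <= k < N.+1) (1 - a * q ^+ k.-1)) (qpoch a q).
Proof.
move=> q0; set u := (fun N => _).
suff ul : is_fps_lim u (Fps (fun n => u n.+1 n)) by rewrite /qpoch (fps_limE ul).
move=> n; exists n.+1; elim=> // m IHm; rewrite leq_eqVlt => /predU1P[<- //|lt_nm].
have -> : u m.+1 = u m * (1 - a * q ^+ m) by rewrite /u big_nat_recr.
rewrite -IHm // mulrBr mulr1 fpsDE fpsNE.
rewrite mulrA fpsME big1 ?subr0 // => i _.
by rewrite (fps_exp_coef0 q0) ?mulr0 // (leq_ltn_trans (leq_subr _ _)).
Qed.

End Ring.

Arguments fpsX {R}.

Section UnitRing.
Variable R : comUnitRingType.
Implicit Types f g : fps R.

Definition fps_unit : pred (fps R) := fun f => f 0%N \is a GRing.unit.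

(* The first n.+1 coefficients of 1 / f. *)
Fixpoint fps_inv_seq f (n : nat) : seq R :=
  if n is m.+1 then
    let s := fps_inv_seq f m in
    rcons s (- ((f 0%N)^-1 * \sum_(i < n) f i.+1 * s`_(m - i)))
  else [:: (f 0%N)^-1].

Definition fps_inv f : fps R :=
  if fps_unit f then Fps (fun n => (fps_inv_seq f n)`_n) else f.

Lemma size_fps_inv_seq f n : size (fps_inv_seq f n) = n.+1.
Proof. by elim: n => //= n IHn; rewrite size_rcons IHn. Qed.

Lemma nth_fps_inv_seq f n i : (i <= n)%N ->
  (fps_inv_seq f n)`_i = (fps_inv_seq f i)`_i.
Proof.
elim: n => [|n IHn]; first by rewrite leqn0 => /eqP ->.
rewrite leq_eqVlt => /predU1P[-> //|lt_in].
by rewrite /= nth_rcons size_fps_inv_seq lt_in IHn.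
Qed.

Fact fps_mulV : {in fps_unit, left_inverse 1 fps_inv *%R}.
Proof.
move=> f; rewrite unfold_in => Uf; rewrite mulrC; apply: fpsP => n.
rewrite fpsME fps1E /fps_inv (_ : fps_unit f = true) //; case: n => [|n].
  by rewrite big_ord1 divrr.
rewrite big_ord_recl subn0 [X in _ * X + _]/= nth_rcons size_fps_inv_seq ltnn eqxx.
rewrite mulrN mulrA (divrr Uf) mul1r addrC (_ : (_ == _)%:R = 0) //.
apply/eqP; rewrite subr_eq0; apply/eqP. apply: eq_bigr => i _.
by rewrite subSS /= [in RHS]nth_fps_inv_seq ?leq_subr.
Qed.

Fact fps_unitPl f g : g * f = 1 -> fps_unit f.
Proof.
move=> /(congr1 (fun h : fps R => h 0%N)); rewrite fpsME big_ord1 => gf1.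
by apply/unitrPr; exists (g 0%N); rewrite mulrC.
Qed.

Fact fps_inv_out : {in [predC fps_unit], fps_inv =1 id}.
Proof. by move=> f /negbTE nUf; rewrite /fps_inv (_ : fps_unit f = false). Qed.

HB.instance Definition _ := GRing.ComNzRing_hasMulInverse.Build (fps R)
  fps_mulV fps_unitPl fps_inv_out.

Lemma fps_unitE f : (f \is a GRing.unit) = (f 0%N \is a GRing.unit).
Proof. by []. Qed.

End UnitRing.

Local Open Scope nat_scope.

(** An overpartition is the list of its parts; the boolean attached to a part
    tells whether it is overlined. *)
Definition overpart := seq (nat * bool).

Definition is_overpartition (s : overpart) : bool :=
  [&& sorted geq (unzip1 s),
      all (fun x => 0 < x.1) s
    & [forall i : 'I_(size s),
        (nth (0, false) s i).2 ==>
          ((nth (0, false) s i).1 \notin take i (unzip1 s))]].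

Definition weight (s : overpart) : nat := sumn (unzip1 s).

Definition overpartition_pairs (n : nat) : set (overpart * overpart) :=
  [set p | [/\ is_overpartition p.1, is_overpartition p.2
             & weight p.1 + weight p.2 = n]]%classic.

Definition pp (n : nat) : nat := #|` fset_set (overpartition_pairs n)|.

(* [fset_set] is only meaningful on finite sets. *)
Lemma overpartition_pairs_finite n : finite_set (overpartition_pairs n).
Proof.
pose T := (n.-bseq ('I_n.+1 * bool))%type.
pose f (t : T) : overpart := [seq (val x.1, x.2) | x <- t].
pose F (t : T * T) := (f t.1, f t.2).
apply: (@sub_finite_set _ _ (F @` setT)%classic); last first.
  exact/finite_image/finite_finset.
have fP s : is_overpartition s -> weight s <= n -> exists t, f t = s.
  case/and3P => _ s_gt0 _ s_le.
  have sz_s : size s <= weight s.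
    elim: s s_gt0 {s_le} => //= x s IHs /andP[x0 /IHs].
    by rewrite /weight /= => IH; rewrite -add1n leq_add.
  have lt_s x : x \in s -> x.1 <= n.
    move=> xs; apply: leq_trans s_le; rewrite /weight.
    elim: s xs {s_gt0 sz_s} => //= y s IHs.
    rewrite inE => /predU1P[->|/IHs le]; first exact: leq_addr.
    exact: leq_trans le (leq_addl _ _).
  have szt : size [seq (inord x.1 : 'I_n.+1, x.2) | x <- s] <= n.
    by rewrite size_map (leq_trans sz_s).
  exists (Bseq szt); rewrite /f /= -map_comp -[RHS]map_id.
  by apply/eq_in_map => -[x b] /lt_s /= x_le; rewrite inordK.
move=> [s1 s2] /= [o1 o2 w].
have [t1 <-] := fP s1 o1 (leq_trans (leq_addr _ _) (eq_leq w)).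
have [t2 <-] := fP s2 o2 (leq_trans (leq_addl _ _) (eq_leq w)).
by exists (t1, t2).
Qed.

(* Main.v *)
Require Import Defs.
From HB Require Import structures.
From mathcomp Require Import all_boot all_order all_algebra all_field.
From mathcomp Require Import finmap boolp classical_sets functions cardinality.
From mathcomp Require Import zify ring.

Set Implicit Arguments.
Unset Strict Implicit.
Unset Printing Implicit Defensive.

Import GRing.Theory.

Local Open Scope ring_scope.

(** Write [E_k] for [(q^k; q^k)_oo] and, after Ramanujan, [phi(q)] for the sum of
    [q^(n^2)] over all integers [n] and [psi(q)] for the sum of [q^(n(n+1)/2)] over the
    naturals.

    Reading an overpartition from its largest part down shows that the generating function
    of overpartitions is [(-q; q)_oo / (q; q)_oo], so that of pairs is its square
    ([pp_seriesE]). By the Jacobi triple product ([jacobi_triple_product]),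
    [phi(-q) = E_1^2 / E_2 = (q; q)_oo / (-q; q)_oo]; hence the series to be dissected is
    [1 / phi(-q)^2] ([pp_series_phi]). The triple product also gives
    [psi(q) = E_2^2 / E_1].

    A dissection of [1 / phi(-q)^2] comes from making its denominator a series in [q^k].
    For [k = 4], use [phi(q) phi(-q) = phi(-q^2)^2] twice ([phi_mulN]); the new numerator
    [phi(q)^2 phi(q^2)^4] is a polynomial in [q], [phi(q^4)] and [psi(q^8)], because
    [phi(q) = phi(q^4) + 2 q psi(q^8)] ([phi_dissect2]) and
    [phi(q^2)^2 = phi(q^4)^2 + 4 q^2 psi(q^8)^2] ([phi_sq_dissect2]). Collecting the
    exponents congruent to [3] modulo [4] leaves one monomial, whence
    [32 psi(q)^6 / phi(-q)^8] ([coef_4n3]).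

    For [k = 3], separating the squares modulo [3] gives [phi(-q) = A - 2 q B] with [A] and
    [B] series in [q^3] ([phi_dissect3]). The product of the conjugates of [phi(-q)] under
    [q -> w q], for [w] the cube roots of unity, is [phi(-q^3)^4 / phi(-q^9)], as one sees
    on the infinite products ([phi_cube_roots]). The numerator is again a polynomial in
    [q], [A] and [B], with one monomial of exponent congruent to [2] modulo [3]
    ([coef_3n2]); the triple product turns [B] into a product as well
    ([theta_6_euler]).

    The square root of [-1] and the cube roots of unity require algebraic coefficients; the
    resulting identities between integral series descend because the map induced on
    series by the inclusion of the integers is injective. *)

(** * Orders and limits of power series *)

Section Limits.
Variable R : comNzRingType.
Implicit Types (f g a b q : fps R) (u v : nat -> fps R).

Definition ord_ge (n : nat) f := forall i, (i < n)%N -> f i = 0.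

Lemma ord_ge0 f : ord_ge 0 f. Proof. by []. Qed.

Lemma ord_geW m n f : (m <= n)%N -> ord_ge n f -> ord_ge m f.
Proof. by move=> le_mn nf i lt_im; apply/nf/(leq_trans lt_im). Qed.

Lemma ord_geD n f g : ord_ge n f -> ord_ge n g -> ord_ge n (f + g).
Proof. by move=> nf ng i lt_in; rewrite fpsDE nf // ng // addr0. Qed.

Lemma ord_geN n f : ord_ge n f -> ord_ge n (- f).
Proof. by move=> nf i lt_in; rewrite fpsNE nf // oppr0. Qed.

Lemma ord_geB n f g : ord_ge n f -> ord_ge n g -> ord_ge n (f - g).
Proof. by move=> nf ng; apply/ord_geD/ord_geN. Qed.

Lemma ord_geM m n f g : ord_ge m f -> ord_ge n g -> ord_ge (m + n) (f * g).
Proof.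
move=> mf ng i lt_i; rewrite fpsME big1 // => -[j /= lt_j] _.
have [lt_jm|le_mj] := ltnP j m; first by rewrite mf // mul0r.
by rewrite ng ?mulr0 //; lia.
Qed.

Lemma ord_geMl n f g : ord_ge n f -> ord_ge n (f * g).
Proof. by move=> nf; rewrite -[n]addn0; apply: ord_geM nf (ord_ge0 g). Qed.

Lemma ord_geMr n f g : ord_ge n g -> ord_ge n (f * g).
Proof. by move=> ng; rewrite mulrC; apply: ord_geMl. Qed.

Lemma ord_geX q n : q 0%N = 0 -> ord_ge n (q ^+ n).
Proof. by move=> q0 i; apply: fps_exp_coef0. Qed.

Lemma ord_ge_sum n I (r : seq I) (P : pred I) (F : I -> fps R) :
  (forall i, P i -> ord_ge n (F i)) -> ord_ge n (\sum_(i <- r | P i) F i).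
Proof.
by move=> nF; elim/big_rec: _ => // i f Pi nf; apply: ord_geD => //; apply: nF.
Qed.

Lemma fps0M f g : (f * g) 0%N = f 0%N * g 0%N.
Proof. by rewrite fpsME big_ord1. Qed.

Lemma fps0X f n : (f ^+ n) 0%N = f 0%N ^+ n.
Proof. by elim: n => // n IHn; rewrite !exprS fps0M IHn. Qed.

Lemma fps_coefM_eq n f f' g g' :
  (forall i, (i <= n)%N -> f i = f' i) -> (forall i, (i <= n)%N -> g i = g' i) ->
  (f * g) n = (f' * g') n.
Proof.
move=> ff' gg'; rewrite !fpsME; apply: eq_bigr => -[i /= lt_i] _.
by rewrite ff' // gg' // leq_subr.
Qed.

Lemma is_fps_lim_upto u f n : is_fps_lim u f ->
  exists N, forall m, (N <= m)%N -> forall i, (i <= n)%N -> u m i = f i.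
Proof.
move=> uf; elim: n => [|n [N IHn]].
  by have [N uN] := uf 0%N; exists N => m /uN e i; rewrite leqn0 => /eqP->.
have [N' uN'] := uf n.+1; exists (maxn N N') => m; rewrite geq_max => /andP[le_N le_N'] i.
by rewrite leq_eqVlt => /predU1P[->|]; [apply: uN' | apply: IHn].
Qed.

Lemma is_fps_lim_cst f : is_fps_lim (fun=> f) f.
Proof. by move=> n; exists 0%N. Qed.

Lemma is_fps_limD u v f g :
  is_fps_lim u f -> is_fps_lim v g -> is_fps_lim (fun n => u n + v n) (f + g).
Proof.
move=> uf vg n; have [[N uN] [N' vN]] := (uf n, vg n).
exists (maxn N N') => m; rewrite geq_max => /andP[le_N le_N'].
by rewrite !fpsDE uN // vN.
Qed.

Lemma is_fps_limN u f : is_fps_lim u f -> is_fps_lim (fun n => - u n) (- f).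
Proof. by move=> uf n; have [N uN] := uf n; exists N => m /uN e; rewrite !fpsNE e. Qed.

Lemma is_fps_limM u v f g :
  is_fps_lim u f -> is_fps_lim v g -> is_fps_lim (fun n => u n * v n) (f * g).
Proof.
move=> uf vg n.
have [[N uN] [N' vN]] := (is_fps_lim_upto n uf, is_fps_lim_upto n vg).
exists (maxn N N') => m; rewrite geq_max => /andP[le_N le_N'].
by apply: fps_coefM_eq => i le_in; [apply: uN | apply: vN].
Qed.

Lemma is_fps_lim_subseq u f (s : nat -> nat) :
  (forall n, (n <= s n)%N) -> is_fps_lim u f -> is_fps_lim (u \o s) f.
Proof.
move=> le_s uf n; have [N uN] := uf n.
by exists N => m le_Nm; apply/uN/(leq_trans le_Nm).
Qed.

Lemma is_fps_lim_eq u v f : u =1 v -> is_fps_lim u f -> is_fps_lim v f.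
Proof. by move=> uv uf n; have [N uN] := uf n; exists N => m /uN; rewrite uv. Qed.

(** The shift by one is what theta series allow: the term [1] of [theta 1 x] comes twice. *)
Lemma is_fps_lim_ord u : (forall n, ord_ge n.-1 (u n)) -> is_fps_lim u 0.
Proof. by move=> u_ n; exists n.+2 => m lt_nm; apply: u_; lia. Qed.

Lemma is_fps_lim_congr u v f : (forall n, ord_ge n.-1 (v n - u n)) ->
  is_fps_lim u f -> is_fps_lim v f.
Proof.
move=> /is_fps_lim_ord uv uf; rewrite -[f]add0r.
by apply: is_fps_lim_eq (is_fps_limD uv uf) => n; rewrite subrK.
Qed.

Lemma is_fps_lim_prod I (r : seq I) (u : I -> nat -> fps R) (f : I -> fps R) :
  (forall i, is_fps_lim (u i) (f i)) ->
  is_fps_lim (fun n => \prod_(i <- r) u i n) (\prod_(i <- r) f i).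
Proof.
move=> uf; elim: r => [|i r IHr].
  by rewrite big_nil; apply: is_fps_lim_eq (is_fps_lim_cst 1) => n; rewrite big_nil.
rewrite big_cons; apply: is_fps_lim_eq (is_fps_limM (uf i) IHr) => n.
by rewrite big_cons.
Qed.

End Limits.

(** * Infinite products *)

Lemma cube_root_unity (R : comNzRingType) (w : R) : 1 + w + w ^+ 2 = 0 -> w ^+ 3 = 1.
Proof.
by move=> w3; apply/eqP; rewrite -subr_eq0 -[X in _ == X](mulr0 (w - 1)) -w3; apply/eqP; ring.
Qed.

Section Qpoch.
Variable R : comNzRingType.
Implicit Types (a b q : fps R).

Definition qpoch_fin a q N : fps R := \prod_(0 <= k < N) (1 - a * q ^+ k).

Lemma qpoch_finS a q N : qpoch_fin a q N.+1 = qpoch_fin a q N * (1 - a * q ^+ N).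
Proof. exact: big_nat_recr. Qed.

Lemma qpoch_finSl a q N : qpoch_fin a q N.+1 = (1 - a) * qpoch_fin (a * q) q N.
Proof.
rewrite /qpoch_fin big_nat_recl // mulr1; congr (_ * _).
by apply: eq_bigr => k _; rewrite exprS mulrA.
Qed.

Lemma qpoch_fin_cvg a q : q 0%N = 0 -> is_fps_lim (qpoch_fin a q) (qpoch a q).
Proof.
move=> /(fps_qpoch_cvg a); apply: is_fps_lim_eq => N.
by rewrite /qpoch_fin big_add1.
Qed.

Lemma qpoch_fin_coef0 a q N : a 0%N = 0 -> (qpoch_fin a q N) 0%N = 1.
Proof.
move=> a0; elim: N => [|N IHN]; first by rewrite /qpoch_fin big_geq.
by rewrite qpoch_finS fps0M IHN mul1r fpsDE fpsNE fps0M a0 mul0r subr0.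
Qed.

Lemma qpoch_coef0 a q : a 0%N = 0 -> q 0%N = 0 -> (qpoch a q) 0%N = 1.
Proof.
move=> a0 q0; have [N /(_ N (leqnn N)) <-] := qpoch_fin_cvg a q0 0%N.
exact: qpoch_fin_coef0.
Qed.

Lemma qpoch_shift a q : q 0%N = 0 -> qpoch a q = (1 - a) * qpoch (a * q) q.
Proof.
move=> q0.
have lim_r := is_fps_limM (is_fps_lim_cst (1 - a)) (qpoch_fin_cvg (a * q) q0).
apply: is_fps_lim_unique _ lim_r.
apply: is_fps_lim_eq (is_fps_lim_subseq leqnSn (qpoch_fin_cvg a q0)) => N /=.
exact: qpoch_finSl.
Qed.

(** Sorts the factors [1 - a * q ^+ i] by the residue of [i] modulo [k]. *)
Lemma qpoch_dissect k a q : (0 < k)%N -> q 0%N = 0 ->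
  qpoch a q = \prod_(r < k) qpoch (a * q ^+ r) (q ^+ k).
Proof.
move=> k_gt0 q0.
have qk0 : (q ^+ k) 0%N = 0 by rewrite fps0X q0 expr0n eqn0Ngt k_gt0.
apply: is_fps_lim_unique _ (is_fps_lim_prod _ (fun r : 'I_k => qpoch_fin_cvg (a * q ^+ r) qk0)).
have le_muln N : (N <= N * k)%N by rewrite leq_pmulr.
apply: is_fps_lim_eq (is_fps_lim_subseq le_muln (qpoch_fin_cvg a q0)) => N /=.
elim: N => [|N IHN].
  by rewrite mul0n /qpoch_fin big_geq // big1 // => r _; rewrite big_geq.
under [RHS]eq_bigr do rewrite qpoch_finS.
rewrite big_split /= -IHN mulSnr /qpoch_fin (big_cat_nat (leq0n _) (leq_addr _ _)) /=.
congr (_ * _).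
rewrite -{1}[(N * k)%N]add0n big_addn addKn big_mkord.
apply: eq_bigr => r _; rewrite -exprM exprD mulnC; ring.
Qed.

Lemma qpoch_mulN a q : q 0%N = 0 ->
  qpoch a q * qpoch (- a) q = qpoch (a ^+ 2) (q ^+ 2).
Proof.
move=> q0; have q20 : (q ^+ 2) 0%N = 0 by rewrite fps0X q0 expr0n.
apply: is_fps_lim_unique _ (qpoch_fin_cvg _ q20).
apply: is_fps_lim_eq (is_fps_limM (qpoch_fin_cvg a q0) (qpoch_fin_cvg (- a) q0)) => N.
by rewrite -big_split; apply: eq_bigr => k _ /=; rewrite -exprM mulnC exprM; ring.
Qed.

Lemma qpoch_mul_cube_roots w a q : 1 + w + w ^+ 2 = 0 -> q 0%N = 0 ->
  qpoch a q * qpoch (w * a) q * qpoch (w ^+ 2 * a) q = qpoch (a ^+ 3) (q ^+ 3).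
Proof.
move=> w3 q0; have q30 : (q ^+ 3) 0%N = 0 by rewrite fps0X q0 expr0n.
apply: is_fps_lim_unique _ (qpoch_fin_cvg _ q30).
have lim c := qpoch_fin_cvg c q0.
apply: is_fps_lim_eq (is_fps_limM (is_fps_limM (lim a) (lim (w * a))) (lim _)) => N.
rewrite -!big_split; apply: eq_bigr => k _ /=; rewrite -exprM mulnC exprM.
set y := q ^+ k; apply/eqP; rewrite -subr_eq0; apply/eqP.
transitivity ((1 + w + w ^+ 2) * (- (a * y) + w * (a * y) ^+ 2 + (1 - w) * (a * y) ^+ 3)).
  by ring.
by rewrite w3 mul0r.
Qed.

End Qpoch.

(** * Gaussian binomial coefficients *)

Section GaussBinomial.
Variables (R : comNzRingType) (Q : R).

(** The Gaussian binomial coefficients, by the one of the two Pascal rules that serves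
    both the expansion of a finite product and the multiplication by a further factor
    in [finite_triple_product]. *)
Fixpoint gbin (n k : nat) : R :=
  match n, k with
  | _, 0%N => 1
  | 0%N, _.+1 => 0
  | n'.+1, k'.+1 => gbin n' k' + Q ^+ k'.+1 * gbin n' k'.+1
  end.

Lemma gbin0 n : gbin n 0 = 1. Proof. by case: n. Qed.

Lemma gbinS n k : gbin n.+1 k.+1 = gbin n k + Q ^+ k.+1 * gbin n k.+1.
Proof. by []. Qed.

Lemma gbin_small n k : (n < k)%N -> gbin n k = 0.
Proof.
elim: n k => [|n IHn] [|k] //= lt_nk.
by rewrite !IHn ?mulr0 ?addr0 // ltnW.
Qed.

Lemma gbinomial_theorem z n :
  \prod_(0 <= i < n) (1 + z * Q ^+ i)
    = \sum_(0 <= k < n.+1) gbin n k * (Q ^+ 'C(k, 2) * z ^+ k).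
Proof.
elim: n z => [|n IHn] z; first by rewrite big_geq // big_nat1 bin0n !mulr1.
rewrite big_nat_recl //.
under eq_bigr do rewrite exprS mulrA.
rewrite IHn mulr1 mulrDl mul1r {1}big_nat_recl // [in RHS]big_nat_recl // gbin0.
rewrite -!addrA; congr (_ + _).
under [in RHS]eq_bigr do rewrite gbinS mulrDl.
rewrite big_split /= addrC; congr (_ + _); last first.
  rewrite [RHS]big_nat_recr //= gbin_small // mulr0 mul0r addr0.
  by apply: eq_bigr => k _; rewrite exprMn; ring.
rewrite mulr_sumr; apply: eq_bigr => k _.
by rewrite binS bin1 exprD exprS exprMn; ring.
Qed.

(** The [q]-factorial [(Q;Q)_n], without the denominators [(1 - Q) ^+ n]; for a series
    [Q], it is [qpoch_fin Q Q n]. *)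
Definition gfact n := \prod_(0 <= i < n) (1 - Q * Q ^+ i).

Lemma gfactS n : gfact n.+1 = gfact n * (1 - Q ^+ n.+1).
Proof. by rewrite /gfact big_nat_recr //= exprS. Qed.

Lemma gbin_fact n k : (k <= n)%N -> gbin n k * gfact k * gfact (n - k) = gfact n.
Proof.
elim: n k => [|n IHn] [|k] // le_kn.
- by rewrite /gfact big_geq // !mulr1.
- by rewrite gbin0 subn0 /gfact big_geq // !mul1r.
rewrite gbinS subSS !gfactS.
have [lt_kn|le_nk] := ltnP k n; last first.
  have -> : k = n by lia.
  by rewrite (@gbin_small n n.+1) // mulr0 addr0 mulrA mulrAC IHn.
have := IHn _ lt_kn; have <- := IHn k (ltnW lt_kn).
rewrite -[(n - k)%N]prednK ?subn_gt0 // -subnS !gfactS.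
set u := gbin _ k; set v := gbin _ k.+1 => e.
have e2 : Q ^+ n.+1 = Q ^+ k.+1 * Q ^+ (n - k.+1).+1 by rewrite -exprD; congr (_ ^+ _); lia.
rewrite e2.
transitivity (u * gfact k * (gfact (n - k.+1) * (1 - Q ^+ (n - k.+1).+1)) * (1 - Q ^+ k.+1)
  + Q ^+ k.+1 * (1 - Q ^+ (n - k.+1).+1) *
    (v * (gfact k * (1 - Q ^+ k.+1)) * gfact (n - k.+1))); first by ring.
rewrite e; ring.
Qed.

End GaussBinomial.

(** * The Jacobi triple product *)

Section TripleProduct.
Variable R : comUnitRingType.
Implicit Types (a b q x y : fps R).

Lemma fps_unit1 f : (f : fps R) 0%N = 1 -> f \is a GRing.unit.
Proof. by move=> f0; rewrite fps_unitE f0 unitr1. Qed.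

Lemma ord_ge_cancel n f g : (f : fps R) 0%N = 1 -> ord_ge n (f * g) -> ord_ge n g.
Proof. by move=> /fps_unit1/mulKr f1 nfg; rewrite -[g]f1; apply: ord_geMr. Qed.

(** The term of index [n >= 0] of Ramanujan's bilateral series
    [sum_n a^(n(n+1)/2) b^(n(n-1)/2)]; the term of index [- n] is [tterm b a n]. *)
Definition tterm a b n := (a * b) ^+ 'C(n, 2) * a ^+ n.

(** The bilateral term of index [k - n], so that [k] runs over natural numbers. *)
Definition btterm a b n k := if (n <= k)%N then tterm a b (k - n) else tterm b a (n - k).

(** Lowering the index by one multiplies the bilateral term of index [j] by
    [b * (a * b) ^ (- j)]; multiplied by [(a * b) ^+ k] with [j = k - n], no
    negative power remains. *)
Lemma btterm_step a b n k :
  b * (a * b) ^+ n * btterm a b n k = (a * b) ^+ k * btterm a b n.+1 k.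
Proof.
rewrite /btterm /tterm; have [le_nk|lt_kn] := leqP n k; last first.
  rewrite leqNgt ltnS (ltnW lt_kn) /= subSn ?(ltnW lt_kn) //.
  have {1}-> : n = (k + (n - k))%N by lia.
  by rewrite binS bin1 [b * a]mulrC !exprD exprS; ring.
have [d ->] : exists d, k = (n + d)%N by exists (k - n)%N; lia.
rewrite addKn; case: d => [|d].
  by rewrite addn0 ltnn subSnn !bin0n (@bin_small 1) //; ring.
rewrite addnS ltnS leq_addr subSS addKn.
by rewrite binS bin1 !exprS !exprD; ring.
Qed.

(** For [n = 0] this is the Gaussian binomial theorem in the single variable [a], with
    [Q = a * b] as an independent base. Each factor [1 + b * Q ^+ n] then shifts the
    index of summation, which is the Pascal rule defining [gbin]. *)
Lemma finite_triple_product a b m n :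
  \prod_(0 <= i < m) (1 + a * (a * b) ^+ i) * \prod_(0 <= i < n) (1 + b * (a * b) ^+ i)
    = \sum_(0 <= k < (m + n).+1) gbin (a * b) (m + n) k * btterm a b n k.
Proof.
elim: n => [|n IHn].
  rewrite [X in _ * X]big_geq // mulr1 gbinomial_theorem addn0.
  by apply: eq_bigr => k _; rewrite /btterm subn0.
rewrite big_nat_recr //= mulrA {}IHn mulrDr mulr1 addnS.
rewrite [in RHS]big_nat_recl // gbin0.
under [in RHS]eq_bigr do rewrite gbinS mulrDl.
rewrite big_split /= addrCA; congr (_ + _).
rewrite mulr_suml.
transitivity (\sum_(0 <= k < (m + n).+2)
    (a * b) ^+ k * gbin (a * b) (m + n) k * btterm a b n.+1 k).
  rewrite [in RHS]big_nat_recr //= gbin_small // mulr0 mul0r addr0.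
  by apply: eq_bigr => k _; rewrite mulrAC -mulrA btterm_step; ring.
by rewrite [in LHS]big_nat_recl // gbin0 mulr1.
Qed.

Lemma ord_ge_tterm a b n : (a * b) 0%N = 0 -> ord_ge n.-1 (tterm a b n).
Proof.
move=> ab0; apply/ord_geMl/(@ord_geW _ _ 'C(n, 2)); last exact: ord_geX.
by case: n => // n; rewrite binS bin1 leq_addl.
Qed.

(** The factors that are added have index above [m]. *)
Lemma ord_ge_gfactB q m n : q 0%N = 0 -> (m <= n)%N ->
  ord_ge m.+1 (gfact q n - gfact q m).
Proof.
move=> q0; elim: n => [|n IHn]; first by rewrite leqn0 => /eqP->; rewrite subrr.
rewrite leq_eqVlt => /predU1P[->|le_mn]; first by rewrite subrr.
rewrite gfactS mulrBr mulr1 addrAC; apply: ord_geB (IHn le_mn) _.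
apply/ord_geMr/(@ord_geW _ _ n.+1) => //; exact: ord_geX.
Qed.

(** By [gbin_fact] the product is a quotient of four [q]-factorials of index at least
    [m], all of them congruent to [gfact q m]. *)
Lemma ord_ge_gbin q m n l k : q 0%N = 0 ->
  (m <= k)%N -> (m + k <= n)%N -> (m <= l)%N ->
  ord_ge m.+1 (gfact q l * gbin q n k - 1).
Proof.
move=> q0 le_mk le_mkn le_ml.
have g0 i : (gfact q i) 0%N = 1 by apply: qpoch_fin_coef0.
apply: (@ord_ge_cancel _ (gfact q k)) => //.
apply: (@ord_ge_cancel _ (gfact q (n - k))) => //.
have -> : gfact q (n - k) * (gfact q k * (gfact q l * gbin q n k - 1))
    = gfact q l * gfact q n - gfact q k * gfact q (n - k).
  by rewrite -[in RHS](@gbin_fact _ q n k); [ring | lia].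
have near i : (m <= i)%N -> ord_ge m.+1 (gfact q i - gfact q m).
  exact: ord_ge_gfactB.
set u := gfact q m in near *.
have -> : gfact q l * gfact q n - gfact q k * gfact q (n - k) =
   (gfact q l - u) * gfact q n + u * (gfact q n - u)
   - (u * (gfact q k - u) + gfact q k * (gfact q (n - k) - u)) by ring.
apply: ord_geB; apply: ord_geD;
  [apply: ord_geMl | apply: ord_geMr | apply: ord_geMr | apply: ord_geMr]; apply: near; lia.
Qed.

Definition theta_sum a b N :=
  \sum_(0 <= n < N.+1) tterm a b n + \sum_(0 <= n < N) tterm b a n.+1.

(** Ramanujan's two-variable theta function, in product form. *)
Definition theta a b := qpoch (- a) (a * b) * qpoch (- b) (a * b) * qpoch (a * b) (a * b).

Lemma theta_sumE a b N :
  theta_sum a b N = \sum_(0 <= k < (N + N).+1) btterm a b N k.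
Proof.
rewrite (@big_cat_nat _ _ _ N) //=; last by lia.
rewrite (big_addn 0 _ N) -addSn addnK addrC /theta_sum; congr (_ + _).
  by apply: eq_bigr => k _; rewrite /btterm leq_addl addnK.
rewrite big_nat_rev; apply: eq_big_nat => k /andP[_ lt_kN].
by rewrite /btterm leqNgt lt_kN /=; congr tterm; lia.
Qed.

(** In [finite_triple_product] with [m = n = N], multiplied by [(ab;ab)_N], the
    coefficient of the term of index [j] is congruent to [1] up to order [N - |j| + 1],
    and that term has order at least [|j| - 1]: the error has order at least [N]. *)
Theorem jacobi_triple_product a b : (a * b) 0%N = 0 ->
  is_fps_lim (theta_sum a b) (theta a b).
Proof.
move=> ab0; have lim c := qpoch_fin_cvg c ab0.
apply: is_fps_lim_congr _ (is_fps_limM (is_fps_limM (lim (- a)) (lim (- b))) (lim (a * b))).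
move=> N; rewrite theta_sumE.
have -> : qpoch_fin (- a) (a * b) N * qpoch_fin (- b) (a * b) N
    = \sum_(0 <= k < (N + N).+1) gbin (a * b) (N + N) k * btterm a b N k.
  rewrite -finite_triple_product; congr (_ * _); apply: eq_bigr => i _; ring.
rewrite mulr_suml -sumrB.
rewrite big_nat_cond; apply: ord_ge_sum => k /andP[/andP[_ lt_k] _].
rewrite -opprB; apply: ord_geN; set m := minn k (N + N - k).
have -> : gbin (a * b) (N + N) k * btterm a b N k * qpoch_fin (a * b) (a * b) N - btterm a b N k =
  (gfact (a * b) N * gbin (a * b) (N + N) k - 1) * btterm a b N k.
  rewrite -[qpoch_fin _ _ _]/(gfact (a * b) N); ring.
have ba0 : (b * a) 0%N = 0 by rewrite mulrC.
apply: (@ord_geW _ _ (m.+1 + (if N <= k then k - N else N - k).-1)%N).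
  by rewrite /m; case: (leqP N k) => ?; lia.
apply: ord_geM; first by apply: ord_ge_gbin => //; rewrite /m; lia.
by rewrite /btterm; case: ifP => _; apply: ord_ge_tterm.
Qed.

Lemma is_fps_lim_tterm a b : (a * b) 0%N = 0 -> is_fps_lim (tterm a b) 0.
Proof. by move=> ab0; apply: is_fps_lim_ord => n; apply: ord_ge_tterm. Qed.

Lemma tterm_exp x i j n :
  tterm (x ^+ i) (x ^+ j) n = x ^+ ((i + j) * 'C(n, 2) + i * n).
Proof. by rewrite /tterm -exprD -!exprM -exprD. Qed.

End TripleProduct.

(** * Theta functions: dissections and product identities *)

Section ThetaIdentities.
(* Keeps [ring] from comparing two products by unfolding them. *)
Local Opaque qpoch.
Variable R : comUnitRingType.
Implicit Types (a b q w x y : fps R).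

Definition euler x := qpoch x x.
(** [phi x] is the sum of [x ^ (n ^ 2)] over all integers [n]. *)
Definition phi x := theta x x.
(** [psi x] is the sum of [x ^+ (n * n.+1)./2] over the naturals [n], that is half of
    [theta 1 x]. The product form makes sense without dividing by [2]. *)
Definition psi x := qpoch (- x) x ^+ 2 * euler x.

Lemma fps0X_eq0 x n : x 0%N = 0 -> (0 < n)%N -> (x ^+ n) 0%N = 0.
Proof. by move=> x0 n_gt0; rewrite fps0X x0 expr0n eqn0Ngt n_gt0. Qed.

Lemma euler_unit x : x 0%N = 0 -> euler x \is a GRing.unit.
Proof. by move=> x0; apply/fps_unit1/qpoch_coef0. Qed.

Lemma double_bin2 n : (2 * 'C(n, 2) + n = n * n)%N.
Proof. by elim: n => // n IHn; rewrite binS bin1; lia. Qed.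

Lemma theta_sumS a b N :
  theta_sum a b N.+1 = theta_sum a b N + (tterm a b N.+1 + tterm b a N.+1).
Proof. by rewrite /theta_sum [X in X + _]big_nat_recr //= [X in _ + X]big_nat_recr //= addrACA. Qed.

Lemma theta_sum0 a b : theta_sum a b 0 = 1.
Proof. by rewrite /theta_sum big_nat1 big_geq // /tterm !mulr1 addr0. Qed.

Lemma tterm_xx x n : tterm x x n = x ^+ (n * n).
Proof. by rewrite -[in LHS](expr1 x) tterm_exp mul1n double_bin2. Qed.

Lemma theta_1l x : x 0%N = 0 -> theta 1 x = 2%:R * psi x.
Proof.
move=> x0; rewrite /theta mul1r (qpoch_shift _ x0) /psi /euler opprK mulN1r; ring.
Qed.

(** The even and the odd squares: [(2 m + 1) ^ 2 = 8 * (m (m + 1) / 2) + 1], and each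
    triangular number comes from two integers [m]. *)
Lemma phi_dissect2 x : x 0%N = 0 ->
  phi x = phi (x ^+ 4) + 2%:R * x * psi (x ^+ 8).
Proof.
move=> x0; pose y := x ^+ 8; have y0 : y 0%N = 0 by apply: fps0X_eq0.
(* The odd numbers between [- 2 N] and [2 N] are the [2 m + 1] with [- N <= m < N], one
   index fewer than in [theta_sum 1 y N]; whence the subtracted term. *)
have e N : theta_sum x x N.*2 = theta_sum (x ^+ 4) (x ^+ 4) N
    + x * (theta_sum 1 y N - tterm y 1 N).
  have t1 n : tterm 1 y n = x ^+ (8 * 'C(n, 2)).
    by rewrite /tterm expr1n mulr1 mul1r -exprM.
  have ty n : tterm y 1 n = x ^+ (8 * 'C(n, 2) + 8 * n).
    by rewrite /tterm mulr1 -!exprM exprD.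
  elim: N => [|N IHN].
    by rewrite !theta_sum0 ty muln0 expr0 subrr mulr0 addr0.
  rewrite doubleS !theta_sumS IHN !tterm_xx -!exprM.
  have E1 : x ^+ (4 * (N.+1 * N.+1)) = x ^+ (N.*2.+2 * N.*2.+2) by congr (_ ^+ _); lia.
  have E2 : x * tterm 1 y N.+1 = x ^+ (N.*2.+1 * N.*2.+1).
    rewrite t1 -exprS; congr (_ ^+ _); have := double_bin2 N.+1; lia.
  have E3 : x * tterm y 1 N = x ^+ (N.*2.+1 * N.*2.+1).
    rewrite ty -exprS; congr (_ ^+ _); have := double_bin2 N; lia.
  rewrite E1 -{1}E2 -E3; move: (x ^+ (N.*2.+2 * _)) (tterm 1 y _) (tterm y 1 _).
  by move: (tterm y 1 _) (theta_sum 1 y _) (theta_sum _ _ _) => t u v w z s; ring.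
have xx0 : (x * x) 0%N = 0 by rewrite fps0M x0 mul0r.
have x40 : (x ^+ 4 * x ^+ 4) 0%N = 0 by rewrite -exprD; apply: fps0X_eq0.
have y10 : (1 * y) 0%N = 0 by rewrite mul1r.
have yl0 : (y * 1) 0%N = 0 by rewrite mulr1.
have le_double N : (N <= N.*2)%N by rewrite -addnn leq_addr.
have L1 := is_fps_lim_subseq le_double (jacobi_triple_product xx0).
have L2 := is_fps_limD (jacobi_triple_product y10) (is_fps_limN (is_fps_lim_tterm yl0)).
have L3 := is_fps_limD (jacobi_triple_product x40) (is_fps_limM (is_fps_lim_cst x) L2).
have := is_fps_lim_unique L1 (is_fps_lim_eq (fun N => esym (e N)) L3).
by rewrite theta_1l // subr0 /phi => ->; ring.
Qed.

(** The squares of [3 m], [3 m + 1] and [3 m - 1]; the last two families give the same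
    exponents, [9 m ^ 2 + 6 m + 1] for integers [m]. *)
Lemma phi_dissect3 x : x 0%N = 0 ->
  phi x = phi (x ^+ 9) + 2%:R * x * theta (x ^+ 15) (x ^+ 3).
Proof.
move=> x0.
have e N : theta_sum x x (3 * N).+1 = theta_sum (x ^+ 9) (x ^+ 9) N
    + 2%:R * x * theta_sum (x ^+ 15) (x ^+ 3) N.
  elim: N => [|N IHN].
    by rewrite muln0 theta_sumS !theta_sum0 !tterm_xx; ring.
  have -> : (3 * N.+1).+1 = (3 * N).+4 by lia.
  rewrite 3![theta_sum x x _]theta_sumS IHN !theta_sumS !tterm_xx -!exprM !tterm_exp.
  set n := N.+1.
  have E1 : x ^+ (9 * (n * n)) = x ^+ ((3 * N).+3 * (3 * N).+3) by congr (_ ^+ _); lia.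
  have E2 : x ^+ ((3 * N).+2 * (3 * N).+2) = x * x ^+ ((3 + 15) * 'C(n, 2) + 3 * n).
    rewrite -exprS; congr (_ ^+ _); have := double_bin2 n; lia.
  have E3 : x ^+ ((3 * N).+4 * (3 * N).+4) = x * x ^+ ((15 + 3) * 'C(n, 2) + 15 * n).
    rewrite -exprS; congr (_ ^+ _); have := double_bin2 n; lia.
  rewrite E1 E2 E3; move: (x ^+ ((3 * N).+3 * _)) (x ^+ (_ + 3 * n)) (x ^+ (_ + 15 * n)) => u v z.
  by move: (theta_sum _ _ _) (theta_sum _ _ _) => s t; ring.
have xx0 : (x * x) 0%N = 0 by rewrite fps0M x0 mul0r.
have x90 : (x ^+ 9 * x ^+ 9) 0%N = 0 by rewrite -exprD; apply: fps0X_eq0.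
have x180 : (x ^+ 15 * x ^+ 3) 0%N = 0 by rewrite -exprD; apply: fps0X_eq0.
have le3 N : (N <= (3 * N).+1)%N by lia.
have L1 := is_fps_lim_subseq le3 (jacobi_triple_product xx0).
have L2 := is_fps_limM (is_fps_lim_cst (2%:R * x)) (jacobi_triple_product x180).
have L3 := is_fps_limD (jacobi_triple_product x90) L2.
exact: is_fps_lim_unique L1 (is_fps_lim_eq (fun N => esym (e N)) L3).
Qed.

Lemma qpoch_dissect2 a q : q 0%N = 0 ->
  qpoch a q = qpoch a (q ^+ 2) * qpoch (a * q) (q ^+ 2).
Proof.
by move=> q0; rewrite (@qpoch_dissect _ 2) // !big_ord_recl big_ord0 !mulr1.
Qed.

Lemma qpoch_dissect3 a q : q 0%N = 0 ->
  qpoch a q = qpoch a (q ^+ 3) * qpoch (a * q) (q ^+ 3) * qpoch (a * q ^+ 2) (q ^+ 3).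
Proof.
by move=> q0; rewrite (@qpoch_dissect _ 3) // !big_ord_recl big_ord0 !mulr1 mulrA.
Qed.

Lemma phiE x : phi x = qpoch (- x) (x ^+ 2) ^+ 2 * euler (x ^+ 2).
Proof. by rewrite /phi /theta -!expr2. Qed.

Lemma phiNE x : phi (- x) = qpoch x (x ^+ 2) ^+ 2 * euler (x ^+ 2).
Proof. by rewrite phiE opprK sqrrN. Qed.

Lemma phiN_euler x : x 0%N = 0 -> phi (- x) * euler (x ^+ 2) = euler x ^+ 2.
Proof.
by move=> x0; rewrite phiNE [in RHS]/euler (qpoch_dissect2 _ x0) -expr2 /euler; ring.
Qed.

Lemma psi_euler x : x 0%N = 0 -> psi x * euler x = euler (x ^+ 2) ^+ 2.
Proof. by move=> x0; rewrite /psi /euler -(qpoch_mulN _ x0); ring. Qed.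

Lemma phi_mulN x : x 0%N = 0 -> phi x * phi (- x) = phi (- x ^+ 2) ^+ 2.
Proof.
move=> x0; have x20 : (x ^+ 2) 0%N = 0 by apply: fps0X_eq0.
rewrite !phiNE phiE.
transitivity ((qpoch x (x ^+ 2) * qpoch (- x) (x ^+ 2) * euler (x ^+ 2)) ^+ 2); first by ring.
rewrite (qpoch_mulN _ x20) [euler (x ^+ 2)](qpoch_dissect2 _ x20) -expr2 /euler; ring.
Qed.

Lemma phi_psi x : x 0%N = 0 -> phi x * psi (x ^+ 2) = psi x ^+ 2.
Proof.
move=> x0; have x20 : (x ^+ 2) 0%N = 0 by apply: fps0X_eq0.
rewrite phiE /psi.
transitivity ((qpoch (- x) (x ^+ 2) * qpoch (- x ^+ 2) (x ^+ 2) * euler (x ^+ 2)) ^+ 2).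
  by ring.
have <- : qpoch (- x) x = qpoch (- x) (x ^+ 2) * qpoch (- x ^+ 2) (x ^+ 2).
  by rewrite (qpoch_dissect2 (- x)) // mulNr -expr2.
rewrite /euler -(qpoch_mulN _ x0); ring.
Qed.

(** The exponents of the factors [1 - x ^+ i] of [theta (- x ^+ 5) (- x)] are the
    [i] congruent to [0], [1] or [5] modulo [6]. *)
Lemma theta_6_euler x : x 0%N = 0 ->
  theta (- x ^+ 5) (- x) * euler (x ^+ 2) * euler (x ^+ 3) = euler x * euler (x ^+ 6) ^+ 2.
Proof.
move=> x0; have x20 : (x ^+ 2) 0%N = 0 by apply: fps0X_eq0.
have x30 : (x ^+ 3) 0%N = 0 by apply: fps0X_eq0.
rewrite /theta mulrNN -exprSr !opprK.
rewrite [euler (x ^+ 3)](qpoch_dissect2 _ x30) [euler x](qpoch_dissect2 _ x0).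
rewrite [qpoch x (x ^+ 2)](qpoch_dissect3 _ x20).
have -> : x ^+ 3 * x ^+ 3 = x ^+ 6 by rewrite -exprD.
have -> : x * (x ^+ 2) ^+ 2 = x ^+ 5 by rewrite -exprM -exprS.
rewrite -!exprM -[x * x ^+ 2]exprS -[x * x]expr2 -[(2 * 3)%N]/6%N -[(3 * 2)%N]/6%N /euler.
move: (qpoch (x ^+ 5) _) (qpoch x _) (qpoch (x ^+ 6) _) (qpoch (x ^+ 3) _).
by move: (qpoch _ _) => a b c d e; ring.
Qed.

(** The product over the three cube roots of unity [c] of [1 - (c * x) ^+ n] is
    [1 - x ^+ (3 * n)] when [3] does not divide [n], and a cube when it does. *)
Lemma euler_cube_roots w x : 1 + w + w ^+ 2 = 0 -> x 0%N = 0 ->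
  euler x * euler (w * x) * euler (w ^+ 2 * x) * euler (x ^+ 9) = euler (x ^+ 3) ^+ 4.
Proof.
move=> w3 x0; have x30 : (x ^+ 3) 0%N = 0 by apply: fps0X_eq0.
have w31 := cube_root_unity w3.
have w0 c : (c * x) 0%N = 0 by rewrite fps0M x0 mulr0.
have split c : c ^+ 3 = 1 -> euler (c * x) =
    qpoch (c * x) (x ^+ 3) * qpoch (c ^+ 2 * x ^+ 2) (x ^+ 3) * euler (x ^+ 3).
  move=> c3; rewrite /euler (qpoch_dissect3 _ (w0 c)).
  have -> : (c * x) ^+ 3 = x ^+ 3 by rewrite exprMn c3 mul1r.
  by rewrite -exprS -expr2 !exprMn c3 mul1r.
have w61 : (w ^+ 2) ^+ 3 = 1 by rewrite exprAC w31 expr1n.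
rewrite (split _ w31) (split _ w61) -{1}[x]mul1r (split 1) ?expr1n //.
have -> : (w ^+ 2) ^+ 2 = w by rewrite -exprM exprS w31 mulr1.
rewrite !mul1r.
have C1 := qpoch_mul_cube_roots x w3 x30.
have C2 := qpoch_mul_cube_roots (x ^+ 2) w3 x30.
have C3 := qpoch_dissect3 (x ^+ 3) x30.
rewrite -!exprM -!exprD in C1 C2 C3.
have C4 : euler (x ^+ 3) =
  qpoch (x ^+ 3) (x ^+ (3 * 3)) * qpoch (x ^+ (2 * 3)) (x ^+ (3 * 3)) * euler (x ^+ 9) := C3.
rewrite -C1 -C2 {C1 C2 C3} in C4; rewrite [RHS]exprS [X in _ = X * _]C4.
move: (euler (x ^+ 3)) (euler _) (qpoch x _) (qpoch (x ^+ 2) _) (qpoch (w * x) _) => {C4}.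
move: (qpoch (w * _) _) (qpoch (w ^+ 2 * x) _) (qpoch _ _) => a b c d e f g h.
by ring.
Qed.

Lemma phi_cube_roots w x : 1 + w + w ^+ 2 = 0 -> x 0%N = 0 ->
  phi (- x) * phi (- (w * x)) * phi (- (w ^+ 2 * x)) * phi (- x ^+ 9) = phi (- x ^+ 3) ^+ 4.
Proof.
move=> w3 x0.
have w31 := cube_root_unity w3.
have w0 c : (c * x) 0%N = 0 by rewrite fps0M x0 mulr0.
have xn0 n : (x ^+ n.+1) 0%N = 0 by apply: fps0X_eq0.
apply: (mulIr (unitrX 4 (euler_unit (xn0 5)))).
have E1 := euler_cube_roots w3 x0.
have E2 : euler (x ^+ 2) * euler (w * x ^+ 2) * euler (w ^+ 2 * x ^+ 2) * euler (x ^+ 18)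
    = euler (x ^+ 6) ^+ 4.
  by have := euler_cube_roots w3 (xn0 1%N); rewrite -!exprM.
have F1 := phiN_euler x0.
have F2 : phi (- (w * x)) * euler (w ^+ 2 * x ^+ 2) = euler (w * x) ^+ 2.
  by have := phiN_euler (w0 w); rewrite exprMn.
have F3 : phi (- (w ^+ 2 * x)) * euler (w * x ^+ 2) = euler (w ^+ 2 * x) ^+ 2.
  by have := phiN_euler (w0 (w ^+ 2)); rewrite exprMn -exprM [_ ^+ (2 * 2)]exprS w31 mulr1.
have F4 : phi (- x ^+ 9) * euler (x ^+ 18) = euler (x ^+ 9) ^+ 2.
  by have := phiN_euler (xn0 8); rewrite -exprM.
have F5 : phi (- x ^+ 3) * euler (x ^+ 6) = euler (x ^+ 3) ^+ 2.
  by have := phiN_euler (xn0 2); rewrite -exprM.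
move: E1 E2 F1 F2 F3 F4 F5.
(* The computation is stated over variables, where it is polynomial algebra. *)
have alg (a b c d e f g h e' f' g' h' k l m : fps R) :
    e * f * g * h = k ^+ 4 -> e' * f' * g' * h' = l ^+ 4 ->
    a * e' = e ^+ 2 -> b * g' = f ^+ 2 -> c * f' = g ^+ 2 -> d * h' = h ^+ 2 ->
    m * l = k ^+ 2 -> a * b * c * d * l ^+ 4 = m ^+ 4 * l ^+ 4.
  move=> E1 E2 F1 F2 F3 F4 F5; rewrite -[RHS]exprMn F5 exprAC -E1 -E2.
  transitivity (a * e' * (b * g') * (c * f') * (d * h')); first by ring.
  by rewrite F1 F2 F3 F4; ring.
exact: alg.
Qed.

End ThetaIdentities.

(** * Coefficient maps, dilations and multisection *)

Section Continuous.
Variables (R S : comNzRingType) (V : {rmorphism fps R -> fps S}).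
Hypothesis V_cont : forall u f, is_fps_lim u f -> is_fps_lim (fun n => V (u n)) (V f).

Lemma rmorph_qpoch (a q : fps R) : q 0%N = 0 -> (V q) 0%N = 0 ->
  V (qpoch a q) = qpoch (V a) (V q).
Proof.
move=> q0 Vq0; have L := V_cont (qpoch_fin_cvg a q0).
apply: is_fps_lim_unique L _.
apply: is_fps_lim_eq (qpoch_fin_cvg (V a) Vq0) => N.
rewrite /qpoch_fin rmorph_prod; apply: eq_bigr => k _.
by rewrite rmorphB rmorph1 rmorphM rmorphXn.
Qed.

End Continuous.

Section PowersOfX.
Variable R : comNzRingType.
Implicit Types f : fps R.

Lemma fpsXME f n : (fpsX * f) n = if n is m.+1 then f m else 0.
Proof.
rewrite fpsME; case: n => [|n]; first by rewrite big_ord1 mul0r.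
rewrite !big_ord_recl /= mul0r add0r mul1r subSS subn0 big1 ?addr0 // => i _.
by rewrite mul0r.
Qed.

Lemma fpsXnME r f n : (fpsX ^+ r * f) n = if (n < r)%N then 0 else f (n - r)%N.
Proof.
elim: r n => [|r IHr] n; first by rewrite mul1r subn0.
by rewrite exprS -mulrA fpsXME; case: n => // n; rewrite IHr.
Qed.

Lemma fpsXnE r n : (fpsX ^+ r : fps R) n = (n == r)%:R.
Proof.
rewrite -[fpsX ^+ r]mulr1 fpsXnME fps1E subn_eq0 eqn_leq.
by case: ltnP => [lt_nr|le_rn]; rewrite ?andbT // andbF.
Qed.

End PowersOfX.

Section FpsMap.
Variables (R S : comNzRingType) (h : {rmorphism R -> S}).

Definition fps_map (f : fps R) : fps S := Fps (fun n => h (f n)).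

Fact fps_map_is_zmod_morphism : zmod_morphism fps_map.
Proof. by move=> f g; apply: fpsP => n /=; rewrite rmorphB. Qed.

Fact fps_map_is_monoid_morphism : monoid_morphism fps_map.
Proof.
split=> [|f g]; apply: fpsP => n /=; first by rewrite rmorph_nat.
by rewrite rmorph_sum; apply: eq_bigr => i _; rewrite rmorphM.
Qed.

HB.instance Definition _ :=
  GRing.isZmodMorphism.Build (fps R) (fps S) fps_map fps_map_is_zmod_morphism.
HB.instance Definition _ :=
  GRing.isMonoidMorphism.Build (fps R) (fps S) fps_map fps_map_is_monoid_morphism.

Lemma fps_map_cont u f : is_fps_lim u f -> is_fps_lim (fun n => fps_map (u n)) (fps_map f).
Proof. by move=> uf n; have [N uN] := uf n; exists N => m /uN /= ->. Qed.

Lemma fps_mapX : fps_map fpsX = fpsX.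
Proof. by apply: fpsP => n /=; rewrite rmorph_nat. Qed.

Lemma fps_map_qpoch (a q : fps R) : q 0%N = 0 ->
  fps_map (qpoch a q) = qpoch (fps_map a) (fps_map q).
Proof.
by move=> q0; apply: (rmorph_qpoch fps_map_cont) => //=; rewrite q0 rmorph0.
Qed.

Lemma fps_map_inj : injective h -> injective fps_map.
Proof.
move=> h_inj f g efg; apply: fpsP => n; apply: h_inj.
exact: (congr1 (fun e : fps S => e n) efg).
Qed.

End FpsMap.

Section Dilation.
Variables (R : comNzRingType) (k : nat).
Implicit Types (f g : fps R).

(** The substitution [f(X ^+ k)]. It is a ring morphism for [k = 0] too, where it keeps
    the constant term only. *)
Definition dilate f : fps R := Fps (fun n => if (k %| n)%N then f (n %/ k)%N else 0).

Fact dilate_is_zmod_morphism : zmod_morphism dilate.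
Proof. by move=> f g; apply: fpsP => n /=; case: ifP => _; rewrite // subr0. Qed.

(** The coefficients up to [m] are those of a composition of polynomials; this gives
    multiplicativity. *)
Lemma dilate_trunc m n f : (n <= m)%N -> (0 < k)%N ->
  dilate f n = (fps_trunc m f \Po 'X^k)`_n.
Proof.
move=> le_nm k_gt0; rewrite coef_comp_poly_Xn //=; case: ifP => // _.
by rewrite fps_truncE // (leq_trans (leq_div _ _)).
Qed.

Fact dilate_is_monoid_morphism : monoid_morphism dilate.
Proof.
split=> [|f g]; apply: fpsP => n /=.
  case: ifP => [/dvdnP[m ->]|kn]; last by case: n kn => // /[!dvdn0].
  case: (posnP k) => [->|k_gt0]; first by rewrite muln0.
  by rewrite mulnK // muln_eq0 (gtn_eqF k_gt0) orbF.
case: (posnP k) => [k0|k_gt0].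
  rewrite k0; case: n => [|n].
    by rewrite dvdn0 div0n !big_ord1.
  rewrite dvd0n /= big1 // => -[[|i] lt_i] _ /=; last by rewrite dvd0n mul0r.
  by rewrite mulr0.
rewrite -[LHS]/(dilate (f * g) n) (@dilate_trunc n) //.
transitivity (((fps_trunc n f * fps_trunc n g) \Po 'X^k)`_n).
  rewrite !coef_comp_poly_Xn //; case: ifP => // _.
  by rewrite fps_truncE ?leq_div // -(fps_mul_trunc f g) ?leq_div.
rewrite rmorphM coefM; apply: eq_bigr => -[i /= lt_i] _.
by rewrite -!dilate_trunc ?leq_subr.
Qed.

HB.instance Definition _ :=
  GRing.isZmodMorphism.Build (fps R) (fps R) dilate dilate_is_zmod_morphism.
HB.instance Definition _ :=
  GRing.isMonoidMorphism.Build (fps R) (fps R) dilate dilate_is_monoid_morphism.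

Lemma dilateN f : dilate (- f) = - dilate f. Proof. exact: rmorphN. Qed.
Lemma dilateM f g : dilate (f * g) = dilate f * dilate g. Proof. exact: rmorphM. Qed.
Lemma dilateXn n f : dilate (f ^+ n) = dilate f ^+ n. Proof. exact: rmorphXn. Qed.

Lemma dilate_cont u f : is_fps_lim u f -> is_fps_lim (fun n => dilate (u n)) (dilate f).
Proof.
move=> uf n; have [N uN] := uf (n %/ k)%N.
by exists N => m /uN /= ->.
Qed.

Lemma dilateX : (0 < k)%N -> dilate fpsX = fpsX ^+ k.
Proof.
move=> k_gt0; apply: fpsP => n; rewrite fpsXnE /=.
case: ifP => [/dvdnP[m ->]|kn].
  by rewrite mulnK // -{2}(mul1n k) eqn_pmul2r.
by case: eqP kn => // ->; rewrite dvdnn.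
Qed.

Lemma dilate_qpoch (a q : fps R) : (0 < k)%N -> q 0%N = 0 ->
  dilate (qpoch a q) = qpoch (dilate a) (dilate q).
Proof.
by move=> k_gt0 q0; apply: (rmorph_qpoch dilate_cont) => //=; rewrite dvdn0 div0n.
Qed.

Lemma coef_Xn_dilate r s f n : (r < k)%N -> (s < k)%N ->
  (fpsX ^+ r * dilate f) (k * n + s)%N = if r == s then f n else 0.
Proof.
move=> lt_rk lt_sk; rewrite fpsXnME /=.
have k_gt0 : (0 < k)%N by apply: leq_ltn_trans lt_rk.
have [->|ne_rs] := eqVneq r s.
  by rewrite ltnNge leq_addl /= addnK dvdn_mulr ?mulKn.
case: ltnP => // le_r; case: ifP => // /dvdnP[m e].
have /(congr1 (modn^~ k)) : (n * k + s = m * k + r)%N by lia.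
by rewrite !modnMDl !modn_small // => e'; rewrite e' eqxx in ne_rs.
Qed.

End Dilation.

(** Dividing by a series in [fpsX ^+ k] commutes with the extraction of the
    coefficients in a residue class modulo [k]. *)
Lemma multisection (R : comUnitRingType) k (f d : fps R) (b : nat -> fps R) s :
  (s < k)%N -> d \is a GRing.unit ->
  f * dilate k d = \sum_(r < k) fpsX ^+ r * dilate k (b r) ->
  Fps (fun n => f (k * n + s)%N) * d = b s.
Proof.
move=> lt_sk Ud fd; apply: (canLR (mulrVK Ud)); apply: fpsP => n.
rewrite -[LHS]/(f (k * n + s)%N).
have -> : f = \sum_(r < k) fpsX ^+ r * dilate k (b r * d^-1).
  under eq_bigr do rewrite rmorphM mulrA.
  by rewrite -mulr_suml -fd -mulrA -rmorphM divrr // rmorph1 mulr1.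
have -> (F : 'I_k -> fps R) m : (\sum_(r < k) F r) m = \sum_(r < k) F r m.
  by elim/big_rec2: _ => // r y z _ <-.
rewrite (bigD1 (Ordinal lt_sk)) // coef_Xn_dilate // eqxx big1 => [|r ne_rs]; first exact: addr0.
by rewrite coef_Xn_dilate // ifN.
Qed.

Lemma multisection_3_2 (R : comUnitRingType) (f d b0 b1 b2 : fps R) :
  d \is a GRing.unit ->
  f * dilate 3 d = dilate 3 b0 + fpsX * dilate 3 b1 + fpsX ^+ 2 * dilate 3 b2 ->
  Fps (fun n => f (3 * n + 2)%N) * d = b2.
Proof.
move=> Ud fd; apply: (@multisection _ _ _ _ (nth 0 [:: b0; b1; b2])) => //.
by rewrite fd !big_ord_recl big_ord0 /= mul1r addr0 addrA.
Qed.

Lemma multisection_4_3 (R : comUnitRingType) (f d b0 b1 b2 b3 : fps R) :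
  d \is a GRing.unit ->
  f * dilate 4 d
    = dilate 4 b0 + fpsX * dilate 4 b1 + fpsX ^+ 2 * dilate 4 b2 + fpsX ^+ 3 * dilate 4 b3 ->
  Fps (fun n => f (4 * n + 3)%N) * d = b3.
Proof.
move=> Ud fd; apply: (@multisection _ _ _ _ (nth 0 [:: b0; b1; b2; b3])) => //.
by rewrite fd !big_ord_recl big_ord0 /= mul1r addr0 !addrA.
Qed.

(** * The two arithmetic progressions *)

Section Dissections.
Variable R : comUnitRingType.
Implicit Types (a b f w x : fps R).
Local Opaque qpoch.

Lemma dilate_theta k a b : (0 < k)%N -> (a * b) 0%N = 0 ->
  dilate k (theta a b) = theta (dilate k a) (dilate k b).
Proof.
move=> k_gt0 ab0; rewrite /theta 2!dilateM.
by rewrite !(dilate_qpoch _ k_gt0 ab0) !dilateN !dilateM.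
Qed.

Lemma dilate_phi k x : (0 < k)%N -> x 0%N = 0 -> dilate k (phi x) = phi (dilate k x).
Proof. by move=> k_gt0 x0; apply: dilate_theta; rewrite // fps0M x0 mul0r. Qed.

Lemma dilate_psi k x : (0 < k)%N -> x 0%N = 0 -> dilate k (psi x) = psi (dilate k x).
Proof.
move=> k_gt0 x0; rewrite /psi dilateM dilateXn /euler.
by rewrite !(dilate_qpoch _ k_gt0 x0) dilateN.
Qed.

Lemma phi_unit x : x 0%N = 0 -> phi x \is a GRing.unit.
Proof.
move=> x0; have x20 : (x * x) 0%N = 0 by rewrite fps0M x0 mul0r.
apply: fps_unit1; rewrite /phi /theta !fps0M !qpoch_coef0 ?mulr1 //.
all: by rewrite fpsNE x0 oppr0.
Qed.

Local Opaque theta phi psi euler.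

(** As [w] is a square root of [-1], [phi_mulN] at [w * x] reads
    [phi (w x) * phi (- w x) = phi (x ^+ 2) ^+ 2]; expand the left-hand side by
    [phi_dissect2]. *)
Lemma phi_sq_dissect2 w x : w ^+ 2 = -1 -> x 0%N = 0 ->
  phi (x ^+ 2) ^+ 2 = phi (x ^+ 4) ^+ 2 + 4%:R * x ^+ 2 * psi (x ^+ 8) ^+ 2.
Proof.
move=> w2 x0; have wx0 : (w * x) 0%N = 0 by rewrite fps0M x0 mulr0.
have nwx0 : (- (w * x)) 0%N = 0 by rewrite fpsNE wx0 oppr0.
have w4 : w ^+ 4 = 1 by rewrite (exprM w 2 2) w2 sqrrN expr1n.
have w8 : w ^+ 8 = 1 by rewrite (exprM w 4 2) w4 expr1n.
have wx2 : - (w * x) ^+ 2 = x ^+ 2 by rewrite exprMn w2 mulN1r opprK.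
have wx4 : (w * x) ^+ 4 = x ^+ 4 by rewrite exprMn w4 mul1r.
have wx8 : (w * x) ^+ 8 = x ^+ 8 by rewrite exprMn w8 mul1r.
have N4 : (- (w * x)) ^+ 4 = x ^+ 4 by rewrite -wx4 exprNn -signr_odd mul1r.
have N8 : (- (w * x)) ^+ 8 = x ^+ 8 by rewrite -wx8 exprNn -signr_odd mul1r.
have P := phi_mulN wx0; rewrite wx2 in P.
have P1 := phi_dissect2 wx0; rewrite wx4 wx8 in P1.
have P2 := phi_dissect2 nwx0; rewrite N4 N8 in P2.
have alg (p p' q A C : fps R) : p * p' = q ^+ 2 ->
    p = A + 2%:R * (w * x) * C -> p' = A + 2%:R * (- (w * x)) * C ->
    q ^+ 2 = A ^+ 2 + 4%:R * x ^+ 2 * C ^+ 2.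
  by move=> <- -> ->; rewrite -wx2; ring.
exact: alg P P1 P2.
Qed.

Local Notation X := (fpsX : fps R).

Lemma fpsX_coef0 : X 0%N = 0. Proof. by []. Qed.

(** By [phi_mulN] twice, [1 / phi (- X) ^+ 2] is
    [phi X ^+ 2 * phi (X ^+ 2) ^+ 4 / phi (- X ^+ 4) ^+ 8]. With [A = phi (X ^+ 4)]
    and [C = psi (X ^+ 8)], the numerator is
    [(A + 2 X C) ^+ 2 * (A ^+ 2 + 4 X ^+ 2 C ^+ 2) ^+ 2], whose only terms in
    [X ^+ (4 n + 3)] are [32 X ^+ 3 A ^+ 3 C ^+ 3]. Finally [phi X * psi (X ^+ 2)]
    is [psi X ^+ 2]. *)
Lemma coef_4n3 w f : w ^+ 2 = -1 -> f * phi (- X) ^+ 2 = 1 ->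
  Fps (fun n => f (4 * n + 3)%N) * phi (- X) ^+ 8 = 32%:R * psi X ^+ 6.
Proof.
move=> w2 f1; have X0 := fpsX_coef0; have X20 := fps0X_eq0 X0 (isT : (0 < 2)%N).
have NX0 : (- X) 0%N = 0 by rewrite fpsNE X0 oppr0.
have dX : dilate 4 X = X ^+ 4 by apply: dilateX.
have da := dilate_phi (isT : (0 < 4)%N) X0; rewrite dX in da.
have dc := dilate_psi (isT : (0 < 4)%N) X20; rewrite dilateXn dX -exprM in dc.
have dd := dilate_phi (isT : (0 < 4)%N) NX0; rewrite dilateN dX in dd.
have P1 := phi_dissect2 X0.
have P2 := phi_sq_dissect2 w2 X0.
have P3 := phi_mulN X0.
have P4 := phi_mulN X20; rewrite -exprM in P4.
have alg (x y p p' q q' r r' A A' C C' g : fps R) :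
    y = x ^+ 4 -> A' = A -> C' = C -> r' = r ->
    p = A + 2%:R * x * C -> q ^+ 2 = A ^+ 2 + 4%:R * x ^+ 2 * C ^+ 2 ->
    p * p' = q' ^+ 2 -> q * q' = r ^+ 2 -> g * p' ^+ 2 = 1 ->
  g * r' ^+ 8 = (A' ^+ 6 + 48%:R * y * (A' ^+ 2 * C' ^+ 4)) +
   x * (4%:R * (A' ^+ 5 * C') + 64%:R * y * (A' * C' ^+ 5)) +
   x ^+ 2 * (12%:R * (A' ^+ 4 * C' ^+ 2) + 64%:R * y * C' ^+ 6) +
   x ^+ 3 * (32%:R * (A' ^+ 3 * C' ^+ 3)).
  move=> -> -> -> -> Ep Eq Ep' Eq' Eg.
  transitivity ((q ^+ 2) ^+ 2 * p ^+ 2 * (g * p' ^+ 2)).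
    transitivity (g * (r ^+ 2) ^+ 4); first by ring.
    rewrite -Eq'; transitivity (g * q ^+ 4 * (q' ^+ 2) ^+ 2); first by ring.
    by rewrite -Ep'; ring.
  by rewrite Eg Eq Ep; ring.
have {alg P1 P2 P3 P4 f1} main := alg _ _ _ _ _ _ _ _ _ _ _ _ _ dX da dc dd P1 P2 P3 P4 f1.
transitivity (32%:R * (phi X ^+ 3 * psi (X ^+ 2) ^+ 3)); last first.
  by rewrite -exprMn phi_psi // -exprM.
have dil (S : comNzRingType) (V : {rmorphism S -> S}) (x A C : S) :
    V (A ^+ 6 + 48%:R * x * (A ^+ 2 * C ^+ 4))
   + x * V (4%:R * (A ^+ 5 * C) + 64%:R * x * (A * C ^+ 5))
   + x ^+ 2 * V (12%:R * (A ^+ 4 * C ^+ 2) + 64%:R * x * C ^+ 6)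
   + x ^+ 3 * V (32%:R * (A ^+ 3 * C ^+ 3))
  = (V A ^+ 6 + 48%:R * V x * (V A ^+ 2 * V C ^+ 4)) +
   x * (4%:R * (V A ^+ 5 * V C) + 64%:R * V x * (V A * V C ^+ 5)) +
   x ^+ 2 * (12%:R * (V A ^+ 4 * V C ^+ 2) + 64%:R * V x * V C ^+ 6) +
   x ^+ 3 * (32%:R * (V A ^+ 3 * V C ^+ 3)).
  by rewrite !(rmorphD, rmorphM, rmorphXn, rmorph_nat).
pose V : {rmorphism fps R -> fps R} := dilate 4.
apply: multisection_4_3 (unitrX 8 (phi_unit NX0))
  (etrans _ (esym (dil _ V X (phi X) (psi (X ^+ 2))))).
rewrite dilateXn; exact: main.
Qed.

(** With [A = phi (- X ^+ 9)] and [B = theta (- X ^+ 15) (- X ^+ 3)], one has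
    [phi (- X) = A - 2 X B]. Multiplying by the conjugates under the cube roots of unity,
    [1 / phi (- X)] is [(A ^+ 2 + 2 X A B + 4 X ^+ 2 B ^+ 2) * A / phi (- X ^+ 3) ^+ 4].
    In the square of the numerator, the only terms in [X ^+ (3 n + 2)] are
    [12 X ^+ 2 A ^+ 4 B ^+ 2]. *)
Lemma coef_3n2 w f : 1 + w + w ^+ 2 = 0 -> f * phi (- X) ^+ 2 = 1 ->
  Fps (fun n => f (3 * n + 2)%N) * phi (- X) ^+ 8
    = 12%:R * (phi (- X ^+ 3) ^+ 4 * theta (- X ^+ 5) (- X) ^+ 2).
Proof.
move=> w3 f1; have X0 := fpsX_coef0.
have NX0 : (- X) 0%N = 0 by rewrite fpsNE X0 oppr0.
have NX30 : (- X ^+ 3) 0%N = 0 by rewrite fpsNE fps0X_eq0 // oppr0.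
have NX50 : (- X ^+ 5 * - X) 0%N = 0 by rewrite fps0M NX0 mulr0.
have dX : dilate 3 X = X ^+ 3 by apply: dilateX.
have dA := dilate_phi (isT : (0 < 3)%N) NX30; rewrite dilateN dilateXn dX -exprM in dA.
have dB := dilate_theta (isT : (0 < 3)%N) NX50.
rewrite !dilateN dilateXn dX -exprM in dB.
have dd := dilate_phi (isT : (0 < 3)%N) NX0; rewrite dilateN dX in dd.
have w31 := cube_root_unity w3.
have dissect c : c ^+ 3 = 1 -> phi (- (c * X))
    = phi (- X ^+ 9) + 2%:R * (- (c * X)) * theta (- X ^+ 15) (- X ^+ 3).
  move=> c3; have cX0 : (- (c * X)) 0%N = 0 by rewrite fpsNE fps0M mulr0 oppr0.
  have pow n : (- (c * X)) ^+ (3 * n.*2.+1) = - X ^+ (3 * n.*2.+1).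
    by rewrite exprNn -signr_odd oddM /= odd_double mulN1r exprMn exprM c3 expr1n mul1r.
  by have := phi_dissect3 cX0; rewrite (pow 0) (pow 1) (pow 2).
have P1 := dissect 1 (expr1n _ _); rewrite mul1r in P1.
have P2 := dissect w w31.
have P3 := dissect (w ^+ 2); rewrite exprAC w31 expr1n in P3.
have {P3}P3 := P3 erefl.
have P4 := phi_cube_roots w3 X0.
have alg (v x y p q r A A' B B' g u u' : fps R) :
    y = x ^+ 3 -> A' = A -> B' = B -> u' = u -> 1 + v + v ^+ 2 = 0 ->
    p = A + 2%:R * (- x) * B -> q = A + 2%:R * (- (v * x)) * B ->
    r = A + 2%:R * (- (v ^+ 2 * x)) * B -> p * q * r * A = u ^+ 4 -> g * p ^+ 2 = 1 ->
  g * u' ^+ 8 = (A' ^+ 6 + 16%:R * y * (A' ^+ 3 * B' ^+ 3)) +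
   x * (4%:R * (A' ^+ 5 * B') + 16%:R * y * (A' ^+ 2 * B' ^+ 4)) +
   x ^+ 2 * (12%:R * (A' ^+ 4 * B' ^+ 2)).
  move=> -> -> -> -> v3 Ep Eq Er Eu Eg.
  transitivity ((q * r) ^+ 2 * A ^+ 2 * (g * p ^+ 2)).
    by transitivity (g * (u ^+ 4) ^+ 2); [ring | rewrite -Eu; ring].
  have -> : q * r = A ^+ 2 + 2%:R * x * (A * B) + 4%:R * x ^+ 2 * B ^+ 2
    + (1 + v + v ^+ 2) * (4%:R * x ^+ 2 * B ^+ 2 * (v - 1) - 2%:R * x * (A * B)).
    by rewrite Eq Er; ring.
  by rewrite v3 Eg; ring.
have {alg P1 P2 P3 P4 f1} main := alg _ _ _ _ _ _ _ _ _ _ _ _ _ dX dA dB dd w3 P1 P2 P3 P4 f1.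
have dil (S : comNzRingType) (V : {rmorphism S -> S}) (x A B : S) :
    V (A ^+ 6 + 16%:R * x * (A ^+ 3 * B ^+ 3))
   + x * V (4%:R * (A ^+ 5 * B) + 16%:R * x * (A ^+ 2 * B ^+ 4))
   + x ^+ 2 * V (12%:R * (A ^+ 4 * B ^+ 2))
  = (V A ^+ 6 + 16%:R * V x * (V A ^+ 3 * V B ^+ 3)) +
   x * (4%:R * (V A ^+ 5 * V B) + 16%:R * V x * (V A ^+ 2 * V B ^+ 4)) +
   x ^+ 2 * (12%:R * (V A ^+ 4 * V B ^+ 2)).
  by rewrite !(rmorphD, rmorphM, rmorphXn, rmorph_nat).
pose V : {rmorphism fps R -> fps R} := dilate 3.
apply: multisection_3_2 (unitrX 8 (phi_unit NX0)) (etrans _ (esym (dil _ V X _ _))).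
rewrite dilateXn; exact: main.
Qed.

Lemma coef_4n3_euler w f : w ^+ 2 = -1 -> f * phi (- X) ^+ 2 = 1 ->
  Fps (fun n => f (4 * n + 3)%N) * euler X ^+ 22 = 32%:R * euler (X ^+ 2) ^+ 20.
Proof.
move=> w2 f1; have X0 := fpsX_coef0.
have alg (g p s e1 e2 : fps R) : g * p ^+ 8 = 32%:R * s ^+ 6 ->
    p * e2 = e1 ^+ 2 -> s * e1 = e2 ^+ 2 -> g * e1 ^+ 22 = 32%:R * e2 ^+ 20.
  move=> Eg Ep Es.
  transitivity (g * (e1 ^+ 2) ^+ 8 * e1 ^+ 6); first by ring.
  rewrite -Ep; transitivity ((g * p ^+ 8) * e2 ^+ 8 * e1 ^+ 6); first by ring.
  rewrite Eg; transitivity (32%:R * (s * e1) ^+ 6 * e2 ^+ 8); first by ring.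
  by rewrite Es; ring.
exact: alg (coef_4n3 w2 f1) (phiN_euler X0) (psi_euler X0).
Qed.

Lemma coef_3n2_euler w f : 1 + w + w ^+ 2 = 0 -> f * phi (- X) ^+ 2 = 1 ->
  Fps (fun n => f (3 * n + 2)%N) * euler X ^+ 14
    = 12%:R * (euler (X ^+ 2) ^+ 6 * euler (X ^+ 3) ^+ 6).
Proof.
move=> w3 f1; have X0 := fpsX_coef0.
have X30 := fps0X_eq0 X0 (isT : (0 < 3)%N).
have U n : euler (X ^+ n.+1) \is a GRing.unit by apply/euler_unit/fps0X_eq0.
have U1 : euler X \is a GRing.unit := U 0%N.
have P := phiN_euler X30; rewrite -exprM in P.
have alg (S : comUnitRingType) (g p r t e1 e2 e3 e6 : S) :
    e1 \is a GRing.unit -> e2 \is a GRing.unit -> e3 \is a GRing.unit -> e6 \is a GRing.unit ->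
    g * p ^+ 8 = 12%:R * (r ^+ 4 * t ^+ 2) -> p * e2 = e1 ^+ 2 -> r * e6 = e3 ^+ 2 ->
    t * e2 * e3 = e1 * e6 ^+ 2 -> g * e1 ^+ 14 = 12%:R * (e2 ^+ 6 * e3 ^+ 6).
  move=> U_1 U_2 U_3 U_6 Eg Ep Er Et.
  have Ue : e1 ^+ 2 * e2 ^+ 2 * e3 ^+ 2 * e6 ^+ 4 \is a GRing.unit.
    by rewrite 3!unitrM (unitrX 2 U_1) (unitrX 2 U_2) (unitrX 2 U_3) (unitrX 4 U_6).
  apply: (mulIr Ue).
  transitivity (g * (e1 ^+ 2) ^+ 8 * (e2 ^+ 2 * e3 ^+ 2 * e6 ^+ 4)); first by ring.
  rewrite -[in LHS]Ep; transitivity ((g * p ^+ 8) * (e2 ^+ 10 * e3 ^+ 2 * e6 ^+ 4)); first by ring.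
  rewrite Eg; transitivity (12%:R * (r * e6) ^+ 4 * (t * e2 * e3) ^+ 2 * e2 ^+ 8).
    by ring.
  by rewrite Er Et; ring.
exact: alg U1 (U 1) (U 2) (U 5) (coef_3n2 w3 f1) (phiN_euler X0) P (theta_6_euler X0).
Qed.

End Dissections.

(** * Counting overpartitions *)

Section Counting.
Local Open Scope nat_scope.
Implicit Types (x y : nat * bool) (s : overpart).

(** An overpartition is a sequence sorted for this transitive relation: equal parts may
    follow each other only if the later one is not overlined. *)
Definition ov_rel x y := (y.1 < x.1) || (y.1 == x.1) && ~~ y.2.

Lemma ov_rel_trans : transitive ov_rel.
Proof. by move=> [y b] [x a] [z c]; rewrite /ov_rel /=; case: b; case: c => /=; lia. Qed.

(** Both conditions of the definition are pairwise ones: an overlined part must differ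
    from every part before it. *)
Lemma is_overpartitionE s :
  is_overpartition s = sorted ov_rel s && all (fun x => 0 < x.1) s.
Proof.
pose C x y := y.2 ==> (y.1 != x.1).
have -> : sorted ov_rel s = sorted geq (unzip1 s) && pairwise C s.
  have geq_trans : transitive geq by move=> ? ? ? /=; lia.
  rewrite (sorted_pairwise ov_rel_trans) (sorted_pairwise geq_trans).
  rewrite pairwise_map -pairwise_relI; apply: eq_pairwise => -[x a] [y b].
  by rewrite /ov_rel /C /=; case: b => /=; lia.
rewrite /is_overpartition [RHS]andbAC -andbA; congr [&& _, _ & _].
apply/forallP/(pairwiseP (0, false)) => [all_s i j /= lt_i lt_j lt_ij|pair_s [i lt_i] /=].
  apply/implyP => s2; have /implyP/(_ s2) := all_s (Ordinal lt_j).
  apply: contraNneq => /= e; have lt_j' : j <= size (unzip1 s) by rewrite size_map ltnW.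
  rewrite e -(nth_map _ 0 fst) // -(nth_take 0 lt_ij) mem_nth // size_takel //.
apply/implyP => s2; apply/negP => /(nthP 0)[j].
rewrite size_takel ?size_map ?(ltnW lt_i) // => lt_ji.
rewrite nth_take // (nth_map (0, false)) ?(ltn_trans lt_ji) // => e.
have /implyP/(_ s2)/eqP[] := pair_s _ _ (ltn_trans lt_ji lt_i) lt_i lt_ji.
by rewrite e.
Qed.

Lemma is_overpartition_cons x s :
  is_overpartition (x :: s) = [&& 0 < x.1, path ov_rel x s & is_overpartition s].
Proof.
rewrite !is_overpartitionE /=; case: (boolP (path _ _ _)) => [p|]; last by rewrite andbF.
by rewrite (path_sorted p).
Qed.

(** Overpartitions of [n] are first components of pairs of [n], the second being empty;
    so the finiteness of the set of pairs gives theirs. *)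
Definition ovps n : seq overpart :=
  [seq s <- undup [seq p.1 | p <- fset_set (overpartition_pairs n)]
     | is_overpartition s && (weight s == n)].

Lemma mem_pairs n p : (p \in fset_set (overpartition_pairs n))
  = [&& is_overpartition p.1, is_overpartition p.2 & weight p.1 + weight p.2 == n].
Proof.
rewrite in_fset_set; last exact: overpartition_pairs_finite.
apply/idP/and3P; rewrite inE => -[o1 o2].
  by move=> /eqP.
by move=> /eqP e.
Qed.

Lemma mem_ovps n s : (s \in ovps n) = is_overpartition s && (weight s == n).
Proof.
rewrite mem_filter andb_idr // => /andP[os ws]; rewrite mem_undup.
apply/mapP; exists (s, [::]) => //.
by rewrite mem_pairs os [is_overpartition _.2]is_overpartitionE /= (eqP ws) addn0 eqxx.
Qed.

Lemma ovps_uniq n : uniq (ovps n).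
Proof. exact/filter_uniq/undup_uniq. Qed.

Lemma pp_sum n : pp n = \sum_(i < n.+1) size (ovps i) * size (ovps (n - i)).
Proof.
have size_sum (T : Type) (w : T -> nat) m (l : seq T) : all (fun p => w p < m) l ->
    size l = \sum_(i < m) count (fun p => w p == i) l.
  elim: l => [|p l IHl] /=; first by rewrite big1.
  move=> /andP[lt_p /IHl ->]; rewrite big_split -add1n; congr (_ + _).
  rewrite (bigD1 (Ordinal lt_p)) // eqxx big1 // => i.
  by rewrite eq_sym => /negbTE ne; rewrite -[X in nat_of_bool X]/(Ordinal lt_p == i) ne.
rewrite /pp (size_sum _ (fun p => weight p.1) n.+1); last first.
  by apply/allP => p; rewrite mem_pairs => /and3P[_ _ /eqP <-]; rewrite ltnS leq_addr.
apply: eq_bigr => i _; rewrite -size_filter -(size_allpairs pair).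
apply/perm_size/uniq_perm => [||[s t]].
- exact/filter_uniq/fset_uniq.
- by apply: allpairs_uniq; rewrite ?ovps_uniq // => -[? ?] [? ?].
rewrite mem_filter mem_pairs /=; apply/idP/allpairsP => [|[[s' t']] /=].
  case/and4P=> /eqP ws os ot wst; exists (s, t); rewrite !mem_ovps os ot ws eqxx /=.
  by split=> //; apply/eqP; lia.
rewrite !mem_ovps => -[/andP[os /eqP ws] /andP[ot /eqP wt] [-> ->]].
by rewrite os ot ws wt eqxx subnKC ?eqxx // -ltnS.
Qed.

Definition ov_count (P : pred overpart) n := count P (ovps n).

Lemma path_ov_rel_mark m b s : path ov_rel (m, b) s = path ov_rel (m, true) s.
Proof. by case: s. Qed.

(** The sequences counted by [P] and not by [Q] are those starting with the part
    [(m, b)]; what follows it is any overpartition that may come after a part [m]. *)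
Lemma ov_count_split (P Q : pred overpart) m b n : 0 < m ->
  (forall s, is_overpartition s -> P s = Q s || (ohead s == Some (m, b))) ->
  (forall s, is_overpartition s -> Q s -> ohead s != Some (m, b)) ->
  ov_count P n = ov_count Q n
    + (if n < m then 0 else ov_count (path ov_rel (m, true)) (n - m)).
Proof.
move=> m_gt0 PQ Q_; rewrite /ov_count.
pose H s := ohead s == Some (m, b).
have ovP s : s \in ovps n -> is_overpartition s by rewrite mem_ovps => /andP[].
rewrite (@eq_in_count _ _ (predU Q H)) => [|s /ovP/PQ //].
have -> : count (predU Q H) (ovps n) = count Q (ovps n) + count H (ovps n).
  rewrite -count_predUI [X in _ + X](@eq_in_count _ _ pred0) ?count_pred0 ?addn0 //.
  by move=> s /ovP/Q_ /=; case: (Q s) => //= /(_ isT)/negbTE.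
congr (_ + _); case: ltnP => [lt_nm|le_mn].
  rewrite (@eq_in_count _ _ pred0) ?count_pred0 // => -[|x s] //.
  rewrite mem_ovps => /andP[_ /eqP ws]; apply/negbTE; apply: contraTN lt_nm => /eqP[xE].
  by rewrite -leqNgt -ws xE /weight /= leq_addr.
rewrite -2!size_filter -[RHS](size_map (cons (m, b))); apply/perm_size/uniq_perm => [||s].
- exact/filter_uniq/ovps_uniq.
- by rewrite map_inj_uniq; [apply/filter_uniq/ovps_uniq | move=> ? ? []].
rewrite mem_filter mem_ovps; apply/idP/mapP => [|[t]].
  case: s => [|x s] //= /andP[/eqP[->]]; rewrite is_overpartition_cons => /andP[/and3P[_ p os]].
  rewrite /weight /= => /eqP ws; exists s => //; rewrite path_ov_rel_mark in p.
  by rewrite mem_filter mem_ovps p os /= /weight -ws addKn.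
rewrite mem_filter mem_ovps => /and3P[p ot /eqP wt] ->.
rewrite is_overpartition_cons m_gt0 path_ov_rel_mark p ot /H eqxx /=.
by rewrite /weight /= -/(weight t) wt subnKC ?eqxx.
Qed.

Lemma path_ov_rel_all m x s :
  path ov_rel x s -> all (fun y => y.1 <= m) (x :: s) = (x.1 <= m).
Proof.
move=> p; rewrite /= andb_idr // => le_xm; apply/allP => y ys.
have /allP/(_ y ys) := order_path_min ov_rel_trans p.
by rewrite /ov_rel; lia.
Qed.

(** The part [m.+1], overlined, comes first or not at all. *)
Lemma ov_count_le m n : ov_count (all (fun x => x.1 <= m.+1)) n
  = ov_count (path ov_rel (m.+1, true)) n
    + (if n < m.+1 then 0 else ov_count (path ov_rel (m.+1, true)) (n - m.+1)).
Proof.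
apply: (@ov_count_split _ _ _ true) => // -[|[x b] s] //;
  rewrite is_overpartition_cons => /and3P[_ p _].
  rewrite (path_ov_rel_all _ p) [in RHS]/= p andbT.
  by rewrite ?[ohead _]/= (inj_eq (@Some_inj _)) xpair_eqE /ov_rel /=; case: b p => _ /=; lia.
move=> /andP[r _]; rewrite [ohead _]/= (inj_eq (@Some_inj _)) xpair_eqE.
by move: r; rewrite /ov_rel /=; case: b p => _ /=; lia.
Qed.

(** The parts that may come after a part [m.+1] are those below [m.+1], and [m.+1]
    itself when not overlined. *)
Lemma ov_count_path m n : ov_count (path ov_rel (m.+1, true)) n
  = ov_count (all (fun x => x.1 <= m)) n
    + (if n < m.+1 then 0 else ov_count (path ov_rel (m.+1, true)) (n - m.+1)).
Proof.
apply: (@ov_count_split _ _ _ false) => // -[|[x b] s] //;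
  rewrite is_overpartition_cons => /and3P[_ p _].
  rewrite (path_ov_rel_all _ p) [in LHS]/= p andbT.
  by rewrite ?[ohead _]/= (inj_eq (@Some_inj _)) xpair_eqE /ov_rel /=; case: b p => _ /=; lia.
rewrite (path_ov_rel_all _ p) [ohead _]/= (inj_eq (@Some_inj _)) xpair_eqE.
by case: b p => _ /=; lia.
Qed.

Lemma ov_count_large m n : n <= m -> ov_count (all (fun x => x.1 <= m)) n = size (ovps n).
Proof.
move=> le_nm; apply/eqP; rewrite -all_count; apply/allP => s; rewrite mem_ovps => /andP[_ /eqP ws].
apply/allP => x xs; apply: leq_trans le_nm; rewrite -ws /weight.
by rewrite (perm_sumn (perm_map fst (perm_to_rem xs))) leq_addr.
Qed.

End Counting.

(** * The generating function of overpartition pairs *)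

Section GeneratingFunctions.
Local Opaque qpoch theta phi euler.
Local Notation X := (fpsX : fps int).

Definition op_series : fps int := Fps (fun n => (size (ovps n))%:Z).
Definition op_le_series m : fps int := Fps (fun n => (ov_count (all (fun x => x.1 <= m)%N) n)%:Z).
Definition op_path_series m : fps int := Fps (fun n => (ov_count (path ov_rel (m, true)) n)%:Z).

Lemma op_le_series0 : op_le_series 0 = 1.
Proof.
apply: fpsP => n; rewrite fps1E natz; congr Posz.
rewrite /ov_count -size_filter.
have -> : (n == 0)%N = size (if n == 0%N then [:: [::] : overpart] else [::]) :> nat by case: eqP.
apply/perm_size/uniq_perm => [||s]; first exact/filter_uniq/ovps_uniq.
  by case: ifP.
rewrite mem_filter mem_ovps is_overpartitionE; case: s => [|[x b] s] /=.
  by rewrite eq_sym; case: ifP.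
by case: x => [|x]; rewrite ?andbF //; case: ifP; rewrite ?inE.
Qed.

(** With [b] the series of what may come after a part [m.+1], the two recurrences read
    [op_le_series m.+1 = (1 + X ^+ m.+1) * b] and
    [op_le_series m = (1 - X ^+ m.+1) * b]. *)
Lemma op_le_seriesS m :
  op_le_series m.+1 * (1 - X * X ^+ m) = op_le_series m * (1 - - X * X ^+ m).
Proof.
have coef r (f : fps int) n : (f + X ^+ r * f) n = f n + (if (n < r)%N then 0 else f (n - r)%N).
  by rewrite fpsDE fpsXnME.
have eA : op_le_series m.+1 = op_path_series m.+1 + X ^+ m.+1 * op_path_series m.+1.
  by apply: fpsP => n; rewrite coef /= ov_count_le PoszD; case: ifP.
have eB : op_path_series m.+1 = op_le_series m + X ^+ m.+1 * op_path_series m.+1.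
  by apply: fpsP => n; rewrite fpsDE fpsXnME /= [in LHS]ov_count_path PoszD; case: ifP.
have alg (S : comNzRingType) (a a' b x y : S) :
    a' = b + y * b -> b = a + y * b -> y = x -> a' * (1 - x) = a * (1 + x).
  move=> -> /(canLR (addrK _)) <- <-; ring.
rewrite mulNr opprK; apply: alg eA eB _; exact: exprS.
Qed.

Lemma op_series_euler : op_series * euler X = qpoch (- X) X.
Proof.
have X0 := fpsX_coef0 int.
have le_lim : is_fps_lim op_le_series op_series.
  by move=> n; exists n => m le_nm /=; rewrite ov_count_large.
have := is_fps_limM le_lim (qpoch_fin_cvg X X0).
move/is_fps_lim_unique; apply; apply: is_fps_lim_eq (qpoch_fin_cvg (- X) X0) => m.
elim: m => [|m IHm]; first by rewrite op_le_series0 /qpoch_fin !big_geq // mulr1.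
rewrite !qpoch_finS IHm mulrAC -op_le_seriesS [RHS]mulrA; exact: mulrAC.
Qed.

(** The series is [(- X; X) / (X; X)], and [phi (- X)] is [(X; X) / (- X; X)]. *)
Lemma op_series_phi : op_series * phi (- X) = 1.
Proof.
have X0 := fpsX_coef0 int; have X20 := fps0X_eq0 X0 (isT : (0 < 2)%N).
have alg (S : comUnitRingType) (o p q e1 e2 : S) : e2 \is a GRing.unit ->
    o * e1 = q -> q * e1 = e2 -> p * e2 = e1 ^+ 2 -> o * p = 1.
  move=> U2 Eo Eq Ep; apply: (mulIr U2); rewrite mul1r -mulrA Ep -Eq -Eo; ring.
apply: alg (euler_unit X20) op_series_euler _ (phiN_euler X0).
by rewrite mulrC; apply: qpoch_mulN.
Qed.

Definition pp_series : fps int := Fps (fun n => (pp n)%:Z).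

Lemma pp_seriesE : pp_series = op_series ^+ 2.
Proof.
apply: fpsP => n; rewrite expr2 fpsME /= pp_sum.
rewrite (big_morph Posz PoszD (erefl _)); apply: eq_bigr => i _; exact: PoszM.
Qed.

Lemma pp_series_phi : pp_series * phi (- X) ^+ 2 = 1.
Proof. by rewrite pp_seriesE -exprMn op_series_phi expr1n. Qed.

End GeneratingFunctions.

(** * Passing to algebraic coefficients and back *)

Section Transfer.
Local Notation XZ := (fpsX : fps int).
Local Notation XC := (fpsX : fps algC).

Definition fpsC (R : comNzRingType) (c : R) : fps R := Fps (fun n => if n is 0%N then c else 0).

Lemma fpsC1 (R : comNzRingType) : fpsC (1 : R) = 1.
Proof. by apply: fpsP => -[]. Qed.

Lemma fpsCD (R : comNzRingType) (c d : R) : fpsC (c + d) = fpsC c + fpsC d.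
Proof. by apply: fpsP => -[|n] //; rewrite fpsDE /= addr0. Qed.

Lemma fpsCM (R : comNzRingType) (c d : R) : fpsC (c * d) = fpsC c * fpsC d.
Proof.
apply: fpsP => n; rewrite fpsME big_ord_recl big1 => [|i _]; last by rewrite mul0r.
by rewrite subn0; case: n => [|n] /=; rewrite ?mulr0 addr0.
Qed.

Lemma sqrt_opp1_algC : exists w : fps algC, w ^+ 2 = -1.
Proof.
exists (fpsC 'i); rewrite expr2 -fpsCM -expr2 Num.Theory.sqrCi.
by apply/eqP; rewrite -subr_eq0 opprK -fpsC1 -fpsCD addNr; apply/eqP/fpsP => -[].
Qed.

Lemma cube_root_algC : exists w : fps algC, 1 + w + w ^+ 2 = 0.
Proof.
have [z z_prim] := C_prim_root_exists (isT : (0 < 3)%N).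
have z3 : 1 + z + z ^+ 2 = 0.
  have /eqP : (z - 1) * (1 + z + z ^+ 2) = 0.
    transitivity (z ^+ 3 - 1); first by ring.
    by rewrite (prim_expr_order z_prim) subrr.
  rewrite mulf_eq0 => /orP[|/eqP //]; rewrite subr_eq0 => /eqP z1.
  have := prim_order_dvd z_prim 1; by rewrite z1 expr1n eqxx.
exists (fpsC z); rewrite expr2 -fpsC1 -fpsCM -!fpsCD -expr2 z3.
by apply: fpsP => -[].
Qed.

Lemma fps_map_theta (R S : comUnitRingType) (h : {rmorphism R -> S}) (a b : fps R) :
  (a * b) 0%N = 0 -> fps_map h (theta a b) = theta (fps_map h a) (fps_map h b).
Proof.
move=> ab0; rewrite /theta; rewrite !(rmorphM, rmorphN) /=.
by rewrite !(fps_map_qpoch _ _ ab0) !(rmorphM, rmorphN).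
Qed.

End Transfer.

Lemma intr_algC_inj : injective (intr : int -> algC).
Proof. exact: intr_inj. Qed.

Section Final.
Local Opaque qpoch theta phi euler.
Local Notation XZ := (fpsX : fps int).
Local Notation toC := (fps_map (intr : int -> algC)).

Lemma toC_phiN : toC (phi (- XZ)) = phi (- fpsX).
Proof.
have NX0 : (- XZ * - XZ) 0%N = 0 by rewrite mulrNN fps0M mul0r.
by rewrite [LHS](fps_map_theta _ NX0) rmorphN /= fps_mapX.
Qed.

Lemma toC_pp_phi : toC pp_series * phi (- fpsX) ^+ 2 = 1.
Proof. by rewrite -toC_phiN -rmorphXn -rmorphM pp_series_phi rmorph1. Qed.

Lemma toC_euler n : toC (euler (XZ ^+ n.+1)) = euler (fpsX ^+ n.+1).
Proof.
have Xn0 : (XZ ^+ n.+1) 0%N = 0 by apply: fps0X_eq0.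
by rewrite [LHS](fps_map_qpoch _ _ Xn0) rmorphXn /= fps_mapX.
Qed.

Lemma toC_euler1 : toC (euler XZ) = euler fpsX.
Proof. exact: (toC_euler 0). Qed.

Lemma toC_pp k s : toC (Fps (fun n => (pp (k * n + s))%:Z))
  = Fps (fun n => toC pp_series (k * n + s)%N).
Proof. by []. Qed.

Theorem pp_3n2 : Fps (fun n => (pp (3 * n + 2))%:Z) * euler XZ ^+ 14
    = 12%:R * (euler (XZ ^+ 2) ^+ 6 * euler (XZ ^+ 3) ^+ 6).
Proof.
have [w w3] := cube_root_algC.
have alg (S T : comNzRingType) (V : {rmorphism S -> T}) a e1 e2 e3 a' e1' e2' e3' :
    V a = a' -> V e1 = e1' -> V e2 = e2' -> V e3 = e3' ->
    a' * e1' ^+ 14 = 12%:R * (e2' ^+ 6 * e3' ^+ 6) ->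
    V (a * e1 ^+ 14) = V (12%:R * (e2 ^+ 6 * e3 ^+ 6)).
  by move=> <- <- <- <-; rewrite !(rmorphM, rmorphXn, rmorph_nat).
apply: (fps_map_inj intr_algC_inj).
exact: (alg _ _ toC _ _ _ _ _ _ _ _ (toC_pp 3 2) toC_euler1 (toC_euler 1) (toC_euler 2)
  (coef_3n2_euler w3 toC_pp_phi)).
Qed.

Theorem pp_4n3 : Fps (fun n => (pp (4 * n + 3))%:Z) * euler XZ ^+ 22
    = 32%:R * euler (XZ ^+ 2) ^+ 20.
Proof.
have [w w2] := sqrt_opp1_algC.
have alg (S T : comNzRingType) (V : {rmorphism S -> T}) a e1 e2 a' e1' e2' :
    V a = a' -> V e1 = e1' -> V e2 = e2' -> a' * e1' ^+ 22 = 32%:R * e2' ^+ 20 ->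
    V (a * e1 ^+ 22) = V (32%:R * e2 ^+ 20).
  by move=> <- <- <-; rewrite !(rmorphM, rmorphXn, rmorph_nat).
apply: (fps_map_inj intr_algC_inj).
exact: (alg _ _ toC _ _ _ _ _ _ (toC_pp 4 3) toC_euler1 (toC_euler 1)
  (coef_4n3_euler w2 toC_pp_phi)).
Qed.

End Final.

Theorem theorem2p1 :
  let q : fps int := fpsX in
  Fps (fun n => (pp (3 * n + 2))%:Z)
    = 12%:R * (qpoch (q ^+ 2) (q ^+ 2) ^+ 6 * qpoch (q ^+ 3) (q ^+ 3) ^+ 6
               / qpoch q q ^+ 14)
  /\
  Fps (fun n => (pp (4 * n + 3))%:Z)
    = 32%:R * (qpoch (q ^+ 2) (q ^+ 2) ^+ 20 / qpoch q q ^+ 22).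
Proof.
have U n : qpoch (fpsX : fps int) fpsX ^+ n \is a GRing.unit.
  exact/unitrX/(euler_unit (fpsX_coef0 _)).
by split; rewrite [RHS]mulrA; apply: canRL (mulrK (U _)) _; [exact: pp_3n2 | exact: pp_4n3].
Qed.
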